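(* Let $\mathcal{D}$ be an essentially small $k$-linear triangulated category and let $\mathfrak{d}$ be the set of isomorphism classes of non-zero objects of $\mathcal{D}$. Let $\mathrm{d}m:\mathrm{Stab}(\mathcal{D})\to\mathscr{M}(\mathbf{R})^{\mathfrak{d}}$ be the map $\sigma\mapsto(\mathrm{d}m_{\sigma,E})_{E\in\mathfrak{d}}$, and let $\ell:\mathrm{Stab}(\mathcal{D})\to\mathbf{C}^{\mathfrak{d}}$ be the composite of $\mathrm{d}m$ with the map $\mathscr{M}(\mathbf{R})^{\mathfrak{d}}\to\mathbf{C}^{\mathfrak{d}}$ given in each coordinate by \[ \mu\mapsto\log\int_{\mathbf{R}}\mathrm{d}\mu+i\pi\,\frac{\int_{\mathbf{R}}\theta\,\mathrm{d}\mu(\theta)}{\int_{\mathbf{R}}\mathrm{d}\mu}. \] Then $\mathrm{d}m$ and $\ell$ are continuous, and both are injective. Furthermore, $\ell$ induces a continuous injection $\overline{\ell}:\mathrm{Stab}(\mathcal{D})/\mathbf{C}\hookrightarrow\mathbf{C}^{\mathfrak{d}}/\mathbf{C}$, where $\mathbf{C}$ acts on $\mathbf{C}^{\mathfrak{d}}$ by componentwise translation.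
   Context: $k$ is a field. A pre-stability condition $\sigma=(Z,\mathcal{P})$ on $\mathcal{D}$ consists of a group homomorphism $Z:K_0(\mathcal{D})\to\mathbf{C}$ and a slicing, i.e. a collection $\mathcal{P}=\{\mathcal{P}(\phi)\}_{\phi\in\mathbf{R}}$ of full additive subcategories of $\mathcal{D}$, such that: (a) $\mathrm{Hom}(\mathcal{P}(\phi),\mathcal{P}(\psi))=0$ if $\phi>\psi$; (b) $\mathcal{P}(\phi)[1]=\mathcal{P}(\phi+1)$; (c) every non-zero object $E$ has a Harder--Narasimhan (HN) filtration $0=E_0\to E_1\to\cdots\to E_n=E$ whose successive cones $G_i=\mathrm{Cone}(E_{i-1}\to E_i)$ (the HN factors, unique up to isomorphism) are non-zero objects of $\mathcal{P}(\phi_i)$ with $\phi_1>\cdots>\phi_n$; (d) $Z(E)\in\mathbf{R}_{>0}e^{i\pi\phi}$ for every non-zero $E\in\mathcal{P}(\phi)$. It is a stability condition if moreover each $\mathcal{P}(\phi)$ is a finite length abelian category. $\mathrm{Stab}(\mathcal{D})$ is the set of stability conditions. For a non-zero object $E$ with HN factors $G_i\in\mathcal{P}(\phi_i)$, $i=1,\dots,n$: $\phi^+_\sigma(E)=\phi_1$, $\phi^-_\sigma(E)=\phi_n$, $m_\sigma(E)=\sum_i|Z(G_i)|$, and the mass measure is $\mathrm{d}m_{\sigma,E}=\sum_{i=1}^n|Z(G_i)|\,\delta_{\phi_i}$. $\mathrm{Stab}(\mathcal{D})$ carries the topology of the generalized metric \[ d(\sigma,\tau)=\sup_{0\ne E\in\mathcal{D}}\left\{|\phi^+_\sigma(E)-\phi^+_\tau(E)|,\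 |\phi^-_\sigma(E)-\phi^-_\tau(E)|,\ \left|\log\tfrac{m_\tau(E)}{m_\sigma(E)}\right|\right\}. \] The additive group $\mathbf{C}$ acts on $\mathrm{Stab}(\mathcal{D})$ by $w\cdot(Z,\mathcal{P})=(e^wZ,\mathcal{P}^w)$ with $\mathcal{P}^w(\phi)=\mathcal{P}(\phi-\Im(w)/\pi)$, and on $\mathbf{C}^{\mathfrak{d}}$ by $w\cdot(z_E)_E=(w+z_E)_E$; orbit spaces have the quotient topology. $\mathscr{M}(\mathbf{R})$ is the set of non-zero, finitely supported, non-negative measures on $\mathbf{R}$ with the weak topology dual to $\mathscr{C}^0(\mathbf{R})$: the coarsest topology for which $\mu\mapsto\int f\,\mathrm{d}\mu$ is continuous for all continuous $f:\mathbf{R}\to\mathbf{R}$. $\mathscr{M}(\mathbf{R})^{\mathfrak{d}}$ and $\mathbf{C}^{\mathfrak{d}}$ have the product topologies. *)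

(* Defs.v *)
From HB Require Import structures.
From mathcomp Require Import all_boot all_order all_algebra.
From mathcomp Require Import freeg.
From mathcomp Require Import all_classical all_reals all_analysis.
From mathcomp Require Import complex ring.

Set Implicit Arguments.
Unset Strict Implicit.
Unset Printing Implicit Defensive.

Import Order.TTheory GRing.Theory Num.Theory.
Import numFieldNormedType.Exports.

Local Open Scope classical_set_scope.
Local Open Scope quotient_scope.
Local Open Scope ring_scope.

Reserved Notation "g \oc f" (at level 40, left associativity).

Record linCat (k : fieldType) := LinCat {
  obj :> Type;
  hom : obj -> obj -> lmodType k;
  idm : forall X, hom X X;
  comp : forall X Y Z, hom Y Z -> hom X Y -> hom X Z;
  comp1m : forall X Y (f : hom X Y), comp (idm Y) f = f;
  compm1 : forall X Y (f : hom X Y), comp f (idm X) = f;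
  compA : forall X Y Z T (h : hom Z T) (g : hom Y Z) (f : hom X Y),
    comp h (comp g f) = comp (comp h g) f;
  comp_linearl : forall X Y Z (f : hom X Y), linear (fun g : hom Y Z => comp g f);
  comp_linearr : forall X Y Z (g : hom Y Z), linear (fun f : hom X Y => comp g f)
}.

Arguments hom {k l} _ _.
Arguments idm {k l} _.
Arguments comp {k l X Y Z} _ _.
Notation "g \oc f" := (comp g f) : ring_scope.

Section LinCatTheory.
Variables (k : fieldType) (C : linCat k).
Implicit Types X Y Z : C.

Definition is_zero X := idm X = 0.

Definition is_iso X Y (f : hom X Y) :=
  exists g : hom Y X, g \oc f = idm X /\ f \oc g = idm Y.

Definition iso X Y := exists f : hom X Y, is_iso f.

Definition is_biproduct X Y B
    (i1 : hom X B) (i2 : hom Y B) (p1 : hom B X) (p2 : hom B Y) :=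
  [/\ p1 \oc i1 = idm X, p2 \oc i2 = idm Y, p2 \oc i1 = 0, p1 \oc i2 = 0 &
      i1 \oc p1 + i2 \oc p2 = idm B].

Definition additive_category :=
  (exists X, is_zero X) /\
  forall X Y, exists B, exists (i1 : hom X B) (i2 : hom Y B)
    (p1 : hom B X) (p2 : hom B Y), is_biproduct i1 i2 p1 p2.

Definition mono X Y (f : hom X Y) :=
  forall W (g h : hom W X), f \oc g = f \oc h -> g = h.

Definition epi X Y (f : hom X Y) :=
  forall W (g h : hom Y W), g \oc f = h \oc f -> g = h.

Definition is_kernel K X Y (f : hom X Y) (i : hom K X) :=
  f \oc i = 0 /\
  forall W (g : hom W X), f \oc g = 0 -> exists! u : hom W K, i \oc u = g.

Definition is_cokernel X Y Q (f : hom X Y) (p : hom Y Q) :=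
  p \oc f = 0 /\
  forall W (g : hom Y W), g \oc f = 0 -> exists! u : hom Q W, u \oc p = g.

Definition abelian_category :=
  [/\ additive_category,
      forall X Y (f : hom X Y), exists K (i : hom K X), is_kernel f i,
      forall X Y (f : hom X Y), exists Q (p : hom Y Q), is_cokernel f p,
      forall X Y (f : hom X Y), mono f -> exists Z (g : hom Y Z), is_kernel g f &
      forall X Y (f : hom X Y), epi f -> exists Z (g : hom Z X), is_cokernel g f].

Definition noetherian E :=
  forall (X : nat -> C) (m : forall n, hom (X n) E)
         (t : forall n, hom (X n) (X n.+1)),
    (forall n, mono (m n)) -> (forall n, m n.+1 \oc t n = m n) ->
    exists N, forall n, (N <= n)%N -> is_iso (t n).

Definition artinian E :=
  forall (X : nat -> C) (m : forall n, hom (X n) E)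
         (t : forall n, hom (X n.+1) (X n)),
    (forall n, mono (m n)) -> (forall n, m n \oc t n = m n.+1) ->
    exists N, forall n, (N <= n)%N -> is_iso (t n).

Definition finite_length := forall E, noetherian E /\ artinian E.

Lemma iso_refl X : iso X X.
Proof. by exists (idm X), (idm X); rewrite !comp1m. Qed.

Lemma iso_sym X Y : iso X Y -> iso Y X.
Proof. by move=> [f [g [gf fg]]]; exists g, f. Qed.

Lemma iso_trans X Y Z : iso X Y -> iso Y Z -> iso X Z.
Proof.
move=> [f [f' [f'f ff']]] [g [g' [g'g gg']]].
exists (g \oc f), (f' \oc g'); split.
  by rewrite -compA [g' \oc _]compA g'g comp1m.
by rewrite -compA [f \oc _]compA ff' comp1m.
Qed.

End LinCatTheory.

Section FullSubcategory.
Variables (k : fieldType) (C : linCat k) (P : C -> Prop).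

Definition full_sub : linCat k :=
  @LinCat k {X : C | P X} (fun X Y => hom (sval X) (sval Y))
    (fun X => idm (sval X)) (fun X Y Z g f => g \oc f)
    (fun X Y f => comp1m f) (fun X Y f => compm1 f)
    (fun X Y Z T h g f => compA h g f)
    (fun X Y Z f => comp_linearl f) (fun X Y Z g => comp_linearr g).

(** A full additive subcategory, closed under isomorphism as usual. *)
Definition additive_subcategory :=
  (forall X Y, iso X Y -> P X -> P Y) /\ additive_category full_sub.

End FullSubcategory.

(** The shift is only assumed to be a k-linear autoequivalence. In the
    octahedral axiom [dist_octa], U, V and W are cones of f, g and g \oc f. *)
Record triCat (k : fieldType) := TriCat {
  tri_lin :> linCat k;
  tri_additive : additive_category tri_lin;
  shift : tri_lin -> tri_lin;
  shiftm : forall X Y, {linear hom X Y -> hom (shift X) (shift Y)};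
  shiftm1 : forall X, shiftm X X (idm X) = idm (shift X);
  shiftmM : forall X Y Z (g : hom Y Z) (f : hom X Y),
    shiftm X Z (g \oc f) = shiftm Y Z g \oc shiftm X Y f;
  shiftm_bij : forall X Y, bijective (shiftm X Y);
  shift_surj : forall X, exists Y, iso (shift Y) X;
  dist : forall X Y Z, hom X Y -> hom Y Z -> hom Z (shift X) -> Prop;
  dist_iso : forall X Y Z (f : hom X Y) (g : hom Y Z) (h : hom Z (shift X))
      X' Y' Z' (f' : hom X' Y') (g' : hom Y' Z') (h' : hom Z' (shift X'))
      (a : hom X X') (b : hom Y Y') (c : hom Z Z'),
    is_iso a -> is_iso b -> is_iso c ->
    b \oc f = f' \oc a -> c \oc g = g' \oc b -> shiftm X X' a \oc h = h' \oc c ->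
    dist f g h -> dist f' g' h';
  dist_id : forall X Z, is_zero Z ->
    dist (idm X) (0 : hom X Z) (0 : hom Z (shift X));
  dist_cone : forall X Y (f : hom X Y),
    exists Z (g : hom Y Z) (h : hom Z (shift X)), dist f g h;
  dist_rot : forall X Y Z (f : hom X Y) (g : hom Y Z) (h : hom Z (shift X)),
    dist f g h <-> dist g h (- shiftm X Y f);
  dist_morph : forall X Y Z (f : hom X Y) (g : hom Y Z) (h : hom Z (shift X))
      X' Y' Z' (f' : hom X' Y') (g' : hom Y' Z') (h' : hom Z' (shift X'))
      (a : hom X X') (b : hom Y Y'),
    dist f g h -> dist f' g' h' -> b \oc f = f' \oc a ->
    exists c : hom Z Z', c \oc g = g' \oc b /\ shiftm X X' a \oc h = h' \oc c;
  dist_octa : forall X Y Z U V W (f : hom X Y) (g : hom Y Z)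
      (p : hom Y U) (p' : hom U (shift X))
      (q : hom Z V) (q' : hom V (shift Y))
      (r : hom Z W) (r' : hom W (shift X)),
    dist f p p' -> dist g q q' -> dist (g \oc f) r r' ->
    exists (u : hom U W) (v : hom W V),
      [/\ dist u v (shiftm Y U p \oc q'), u \oc p = r \oc g, r' \oc u = p',
          v \oc r = q & q' \oc v = shiftm X Y f \oc r']
}.

Arguments shift {k t} _.
Arguments shiftm {k t X Y}.
Arguments dist {k t X Y Z} _ _ _.

Section K0.
Variables (k : fieldType) (D : triCat k).

Definition free_obj : zmodType := {freeg {classic D} / int}.

Definition free_cls (X : D) : free_obj := [freeg [:: (1%:Z, X : {classic D})]].

(** The subgroup generated by the elements [Y] - [X] - [Z] for all
    distinguished triangles X -> Y -> Z -> X[1]. *)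
Definition K0_rel : {pred free_obj} := fun x =>
  `[< forall S : set free_obj, S 0 -> (forall y z, S y -> S z -> S (y - z)) ->
      (forall X Y Z (f : hom X Y) (g : hom Y Z) (h : hom Z (shift X)),
         dist f g h -> S (free_cls Y - free_cls X - free_cls Z)) ->
      S x >].

Lemma K0_rel_closed : zmod_closed K0_rel.
Proof.
split=> [|x y]; rewrite !unfold_in.
  by apply/asboolP => S S0 SB Sd; exact: S0.
move=> Hx Hy; apply/asboolP => S S0 SB Sd.
by apply: (SB); [exact: (asboolW Hx)|exact: (asboolW Hy)].
Qed.

HB.instance Definition _ := GRing.isZmodClosed.Build free_obj K0_rel K0_rel_closed.

Definition K0 : zmodType := ring_quotient.Quotient.quot K0_rel.

Definition cls (X : D) : K0 := \pi_K0 (free_cls X).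

End K0.

Section Slicing.
Variables (R : realType) (k : fieldType) (D : triCat k).

Definition nzobj := {E : D | ~ is_zero E}.

(** [tower E [:: G1; ...; Gn]]: there are morphisms 0 = E0 -> ... -> En = E
    such that Gi is a cone of E(i-1) -> Ei. *)
Inductive tower : D -> seq {classic D} -> Prop :=
| tower_nil X : is_zero X -> tower X [::]
| tower_rcons X Y G s (f : hom X Y) (g : hom Y G) (h : hom G (shift X)) :
    tower X s -> dist f g h -> tower Y (rcons s G).

(** A Harder-Narasimhan filtration of E is recorded as the list of its
    factors paired with their phases. *)
Definition is_HN (P : R -> D -> Prop) (E : D) (s : seq ({classic D} * R)) :=
  [/\ tower E (unzip1 s),
      sorted (fun x y => y < x) (unzip2 s) &
      forall G, G \in s -> ~ is_zero (G.1 : D) /\ P G.2 G.1].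

Definition is_slicing (P : R -> D -> Prop) :=
  [/\ forall phi, additive_subcategory (P phi),
      forall phi psi X Y (f : hom X Y), psi < phi -> P phi X -> P psi Y -> f = 0,
      forall phi Y, P (phi + 1) Y <-> exists2 X, P phi X & iso (shift X) Y &
      forall E : nzobj, exists s, is_HN P (sval E) s].

Definition cexp (w : R[i]) : R[i] :=
  (expR (complex.Re w))%:C%C * (cos (complex.Im w) +i* sin (complex.Im w))%C.

Record stab := Stab {
  charge : {additive K0 D -> R[i]};
  slice : R -> D -> Prop;
  slice_slicing : is_slicing slice;
  charge_slice : forall phi E, slice phi E -> ~ is_zero E ->
    exists2 r : R, 0 < r & charge (cls E) = r%:C%C * cexp (0 +i* (pi * phi))%C;
  slice_abelian : forall phi, abelian_category (full_sub (slice phi));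
  slice_finite_length : forall phi, finite_length (full_sub (slice phi))
}.

HB.instance Definition _ := gen_eqMixin stab.
HB.instance Definition _ := gen_choiceMixin stab.

End Slicing.

Arguments nzobj {k} D.
Arguments stab R {k} D.

Section Mass.
Variables (R : realType) (k : fieldType) (D : triCat k).
Implicit Types (sigma tau : stab R D) (E : nzobj D).

Local Notation normc := ComplexField.Normc.normc.

(** HN filtrations are unique up to isomorphism, so nothing below depends on
    the choice made here. *)
Definition HN sigma E : seq ({classic D} * R) :=
  let: And4 _ _ _ ex := slice_slicing sigma in sval (cid (ex E)).

Lemma HNP sigma E : is_HN (slice sigma) (sval E) (HN sigma E).
Proof. by rewrite /HN; case: (slice_slicing sigma) => _ _ _ ex; case: cid. Qed.

Definition absZ sigma (X : D) : R := normc (charge sigma (cls X)).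

Definition phi_plus sigma E : R := head 0 (unzip2 (HN sigma E)).

Definition phi_minus sigma E : R := last 0 (unzip2 (HN sigma E)).

Definition mass sigma E : R := \sum_(G <- HN sigma E) absZ sigma G.1.

(** The supremum is over an empty set, hence -oo, only when D = 0, in which
    case there is a single stability condition. *)
Definition stab_dist sigma tau : \bar R := ereal_sup
  [set x | exists E : nzobj D,
     [\/ x = `|phi_plus sigma E - phi_plus tau E|%:E,
         x = `|phi_minus sigma E - phi_minus tau E|%:E |
         x = `|ln (mass tau E / mass sigma E)|%:E]].

Definition stab_ball sigma (e : R) tau := (stab_dist sigma tau < e%:E)%E.

Lemma cexp_norm (w : R[i]) : normc (cexp w) = expR (complex.Re w).
Proof.
rewrite /cexp ComplexField.Normc.normcM /= cos2Dsin2 sqrtr1 mulr1.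
by rewrite expr0n /= addr0 sqrtr_sqr ger0_norm// expR_ge0.
Qed.

Lemma absZ_gt0 sigma E (G : {classic D} * R) :
  G \in HN sigma E -> 0 < absZ sigma G.1.
Proof.
have [_ _ H] := HNP sigma E => /H[G0 /charge_slice/(_ G0)[r r0]].
rewrite /absZ => ->; rewrite ComplexField.Normc.normcM cexp_norm /= expR0 mulr1.
by rewrite expr0n /= addr0 sqrtr_sqr gtr0_norm.
Qed.

Lemma HN_neq0 sigma E : HN sigma E != [::].
Proof.
apply/eqP => E0; have [] := HNP sigma E; rewrite E0 /= => + _ _.
move Es : [::] => s Ht; case: Ht Es (svalP E) => // X Y G [] //.
Qed.

Lemma mass_gt0 sigma E : 0 < mass sigma E.
Proof.
rewrite /mass; have := @absZ_gt0 sigma E; have := HN_neq0 sigma E.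
case: (HN sigma E) => // G s _ H; rewrite big_cons ltr_wpDr//.
  rewrite big_seq; apply: sumr_ge0 => i si; apply/ltW/H.
  by rewrite inE si orbT.
by apply: H; rewrite inE eqxx.
Qed.

End Mass.

Section StabTopology.
Variables (R : realType) (k : fieldType) (D : triCat k).
Implicit Types sigma tau : stab R D.

Lemma stab_ball_center sigma (e : R) : 0 < e -> stab_ball sigma e sigma.
Proof.
move=> e0; apply: (@le_lt_trans _ _ 0%E); last by rewrite lte_fin.
apply: ge_ereal_sup => _ [E] [] ->; rewrite ?subrr ?normr0//.
by rewrite divff ?ln1 ?normr0// gt_eqF// mass_gt0.
Qed.

Lemma ln_mass_dist sigma tau (E : nzobj D) :
  ln (mass tau E / mass sigma E) = ln (mass tau E) - ln (mass sigma E).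
Proof. by rewrite ln_div ?posrE ?mass_gt0. Qed.

Lemma stab_dist_sym sigma tau : stab_dist sigma tau = stab_dist tau sigma.
Proof.
congr ereal_sup; apply/seteqP.
by split=> x [E] [] ->; exists E; rewrite ?ln_mass_dist distrC;
   [apply: Or31|apply: Or32|apply: Or33|apply: Or31|apply: Or32|apply: Or33].
Qed.

Lemma stab_ball_sym sigma tau (e : R) :
  stab_ball sigma e tau -> stab_ball tau e sigma.
Proof. by rewrite /stab_ball stab_dist_sym. Qed.

Lemma stab_dist_ge sigma tau (E : nzobj D) :
  [/\ (`|phi_plus sigma E - phi_plus tau E|%:E <= stab_dist sigma tau)%E,
      (`|phi_minus sigma E - phi_minus tau E|%:E <= stab_dist sigma tau)%E &
      (`|ln (mass tau E / mass sigma E)|%:E <= stab_dist sigma tau)%E].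
Proof.
by split; apply: ereal_sup_ubound; exists E;
  [apply: Or31|apply: Or32|apply: Or33].
Qed.

Lemma stab_ball_triangle sigma tau ups (e1 e2 : R) :
  stab_ball sigma e1 tau -> stab_ball tau e2 ups ->
  stab_ball sigma (e1 + e2) ups.
Proof.
rewrite /stab_ball => d1 d2.
have [e' d1' e'1] : exists2 e', (stab_dist sigma tau <= e'%:E)%E & e' < e1.
  case Ed : (stab_dist sigma tau) d1 => [r| |]//; last first.
    by move=> _; exists (e1 - 1); rewrite ?leNye// ltrBlDr ltrDl.
  by rewrite lte_fin => re; exists r.
apply: (@le_lt_trans _ _ (e' + e2)%:E); last by rewrite lte_fin ltrD2r.
apply: ge_ereal_sup => x [E xE].
have [p1 m1 l1] := stab_dist_ge sigma tau E.
have [p2 m2 l2] := stab_dist_ge tau ups E.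
have tri (a b c : R) : (`|a - b|%:E <= stab_dist sigma tau)%E ->
    (`|b - c|%:E <= stab_dist tau ups)%E -> (`|a - c|%:E <= (e' + e2)%:E)%E.
  move=> /le_trans/(_ d1') + /le_lt_trans/(_ d2); rewrite !lee_fin lte_fin => ab bc.
  by rewrite (le_trans (ler_distD b _ _))// lerD// ltW.
case: xE => ->; [exact: tri p1 p2|exact: tri m1 m2|].
move: l1 l2; rewrite !ln_mass_dist distrC => l1; rewrite distrC => l2.
by rewrite distrC; exact: tri l1 l2.
Qed.

HB.instance Definition _ :=
  hasNbhs.Build (stab R D) (nbhs_ (entourage_ (@stab_ball R k D))).
HB.instance Definition _ := Nbhs_isPseudoMetric.Build R (stab R D)
  erefl stab_ball_center stab_ball_sym stab_ball_triangle erefl.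

End StabTopology.

Section Measures.
Variable R : realType.

(** The last condition says that the finite set A carries the measure; asking
    it for arbitrary and not just Borel sets B has the effect that a finitely
    supported measure is determined by its values on Borel sets. *)
Record fsmeasure := FsMeasure {
  fsm :> {measure set (measurableTypeR R) -> \bar R};
  fsm_neq0 : fsm setT != 0%E;
  fsm_finite : (fsm setT < +oo)%E;
  fsm_support : exists2 A : set R, finite_set A &
    forall B : set R, fsm B = fsm (B `&` A)
}.

HB.instance Definition _ := gen_eqMixin fsmeasure.
HB.instance Definition _ := gen_choiceMixin fsmeasure.

Definition fsm_integral (f : R -> R) (mu : fsmeasure) : R :=
  (\int[fsm mu]_x f x)%R.

(** The coarsest topology making [fsm_integral f] continuous for every
    continuous f. *)
Definition fsmeasure_weak :=
  sup_topology (fun f : {f : R -> R | continuous f} =>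
    Topological.class (initial_topology (fsm_integral (sval f)))).

HB.instance Definition _ := Topological.copy fsmeasure fsmeasure_weak.

Definition log_barycenter (mu : fsmeasure) : R[i] :=
  (ln (fsm_integral (cst 1) mu) +i*
   (pi * (fsm_integral id mu / fsm_integral (cst 1) mu)))%C.

End Measures.

Section MassMeasure.
Variables (R : realType) (k : fieldType) (D : triCat k).
Implicit Types (sigma tau : stab R D) (E : nzobj D).

Lemma absZ_ge0 sigma (X : D) : 0 <= absZ sigma X.
Proof. by rewrite /absZ; case: (charge _ _) => a b; exact: sqrtr_ge0. Qed.

Definition mass_measure sigma E : {measure set (measurableTypeR R) -> \bar R} :=
  let G i := nth (sval E : {classic D}, 0) (HN sigma E) i in
  msum (fun i => mscale (NngNum (absZ_ge0 sigma (G i).1))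
                        (\d_ ((G i).2 : measurableTypeR R)))
       (size (HN sigma E)).

Lemma mass_measureE sigma E (B : set R) : mass_measure sigma E B =
  (\sum_(G <- HN sigma E) (absZ sigma G.1)%:E * \d_(G.2) B)%E.
Proof. by rewrite (big_nth (sval E : {classic D}, 0)) big_mkord. Qed.

Lemma mass_measureT sigma E : mass_measure sigma E setT = (mass sigma E)%:E.
Proof.
rewrite mass_measureE -sumEFin; apply: eq_bigr => G _.
by rewrite diracT mule1.
Qed.

Lemma mass_measure_neq0 sigma E : mass_measure sigma E setT != 0%E.
Proof. by rewrite mass_measureT eqe gt_eqF// mass_gt0. Qed.

Lemma mass_measure_finite sigma E : (mass_measure sigma E setT < +oo)%E.
Proof. by rewrite mass_measureT ltry. Qed.

Lemma mass_measure_support sigma E : exists2 A : set R, finite_set A &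
  forall B : set R, mass_measure sigma E B = mass_measure sigma E (B `&` A).
Proof.
exists [set` unzip2 (HN sigma E)]; first exact: finite_seq.
move=> B; rewrite !mass_measureE big_seq [RHS]big_seq; apply: eq_bigr => G Gs.
congr (_ * _)%E; rewrite !diracE; congr (_%:R%:E); congr nat_of_bool.
rewrite in_setI [X in _ && X]mem_set ?andbT//=.
by apply/mapP; exists G.
Qed.

Definition mass_fsmeasure sigma E : fsmeasure R :=
  FsMeasure (mass_measure_neq0 sigma E) (mass_measure_finite sigma E)
    (mass_measure_support sigma E).

End MassMeasure.

Section IsoClasses.
Variables (k : fieldType) (D : triCat k).

HB.instance Definition _ := gen_eqMixin (nzobj D).
HB.instance Definition _ := gen_choiceMixin (nzobj D).

Definition nz_iso : rel (nzobj D) := fun E F => `[< iso (sval E) (sval F) >].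

Lemma nz_iso_equiv : equiv_class_of nz_iso.
Proof.
split=> [E|E F|F E G].
- exact/asboolP/iso_refl.
- by apply/asboolP/asboolP; exact: iso_sym.
- by move=> /asboolP EF /asboolP FG; apply/asboolP/(iso_trans EF FG).
Qed.

Canonical nz_iso_rel := EquivRelPack nz_iso_equiv.

(** The objects and morphisms of a [triCat] form types, so isomorphism classes
    form a type as well: smallness needs no separate hypothesis. *)
Definition isoclass := {eq_quot nz_iso}.

End IsoClasses.

Arguments isoclass {k} D.

Section Maps.
Variables (R : realType) (k : fieldType) (D : triCat k).

Definition Mprod : topologicalType :=
  prod_topology (fun _ : isoclass D => fsmeasure R).

Definition Cprod : topologicalType :=
  prod_topology (fun _ : isoclass D => R[i]^o).

Definition dm (sigma : stab R D) : Mprod :=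
  fun E => mass_fsmeasure sigma (repr E).

Definition ell (sigma : stab R D) : Cprod :=
  fun E => log_barycenter (dm sigma E).

End Maps.

Arguments Mprod R {k} D.
Arguments Cprod R {k} D.

Section Orbits.
Variables (G : zmodType) (T : choiceType) (act : G -> T -> T).
Hypothesis act0 : forall x, act 0 x = x.
Hypothesis actD : forall v w x, act (v + w) x = act v (act w x).

Definition in_orbit : rel T := fun x y => `[< exists w, y = act w x >].

Lemma in_orbit_equiv : equiv_class_of in_orbit.
Proof.
have sym x y : in_orbit x y -> in_orbit y x.
  by move=> /asboolP[w ->]; apply/asboolP; exists (- w); rewrite -actD addNr act0.
split=> [x|x y|y x z].
- by apply/asboolP; exists 0.
- by apply/idP/idP; exact: sym.
- move=> /asboolP[v ->] /asboolP[w ->]; apply/asboolP.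
  by exists (w + v); rewrite actD.
Qed.

End Orbits.

Section CAction.
Variables (R : realType) (k : fieldType) (D : triCat k).

Lemma cexp0 : cexp 0 = 1 :> R[i].
Proof. by rewrite /cexp /= expR0 cos0 sin0 mul1r. Qed.

Lemma cexpD (v w : R[i]) : cexp (v + w) = cexp v * cexp w.
Proof.
case: v w => a b [c d]; rewrite /cexp /= expRD cosD sinD.
by apply/eqP; rewrite eq_complex /=; apply/andP; split; apply/eqP; ring.
Qed.

Lemma cexp_real (a : R) : cexp (a +i* 0)%C = (expR a)%:C%C.
Proof. by rewrite /cexp /= cos0 sin0 mulr1. Qed.

Section Act.
Variables (w : R[i]) (sigma : stab R D).

Definition act_charge : {additive K0 D -> R[i]} := cexp w \*o charge sigma.

Definition act_slice (phi : R) : D -> Prop :=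
  slice sigma (phi - complex.Im w / pi).

Lemma act_slicing : is_slicing act_slice.
Proof.
have [add hom0 sh hn] := slice_slicing sigma; split.
- by move=> phi; exact: add.
- move=> phi psi X Y f lt; rewrite /act_slice; apply: hom0.
  by rewrite ltrD2r.
- by move=> phi Y; rewrite /act_slice [phi + 1 - _]addrAC; exact: sh.
- move=> E; have [s [tw so ss]] := hn E.
  pose t (G : {classic D} * R) := (G.1, G.2 + complex.Im w / pi).
  exists (map t s); split.
  + by rewrite /unzip1 -map_comp; exact: tw.
  + move: so; rewrite /unzip2 -map_comp !sorted_map; apply: sub_sorted.
    by move=> x y /=; rewrite ltrD2r.
  + by move=> _ /mapP[G Gs ->] /=; rewrite /act_slice addrK; exact: ss.
Qed.

Lemma act_charge_slice phi E : act_slice phi E -> ~ is_zero E ->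
  exists2 r : R, 0 < r & act_charge (cls E) = r%:C%C * cexp (0 +i* (pi * phi))%C.
Proof.
move=> Ephi E0; have [r r0 Er] := charge_slice Ephi E0.
exists (expR (complex.Re w) * r); first by rewrite mulr_gt0// expR_gt0.
rewrite /act_charge /= Er mulrCA -cexpD rmorphM /= -cexp_real.
rewrite [RHS]mulrAC -cexpD [RHS]mulrC; congr (_ * cexp _).
case: (w) => a b /=; apply/eqP; rewrite eq_complex /= addr0 add0r eqxx /=.
by rewrite mulrBr [pi * (b / pi)]mulrC divfK ?subrKC// gt_eqF ?pi_gt0.
Qed.

Definition stab_act : stab R D :=
  @Stab R k D act_charge act_slice act_slicing act_charge_slice
    (fun phi => @slice_abelian R k D sigma (phi - complex.Im w / pi))
    (fun phi => @slice_finite_length R k D sigma (phi - complex.Im w / pi)).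

End Act.

Lemma stab_eq (sigma tau : stab R D) :
  charge sigma =1 charge tau -> slice sigma = slice tau -> sigma = tau.
Proof.
case: sigma tau => [Z P a b c d] [Z' P' a' b' c' d'] /= ZZ' PP'.
have {ZZ'}EZ : Z = Z'.
  case: Z Z' ZZ' {b b'} => [f cf] [g cg] /= /funext fg.
  case: _ / fg in cg *; case: cf cg => [[m]] [[n]].
  by rewrite (Prop_irrelevance m n).
by subst Z' P'; congr Stab; exact: Prop_irrelevance.
Qed.

Lemma stab_act0 sigma : stab_act 0 sigma = sigma.
Proof.
apply: stab_eq => [x|] /=; first by rewrite cexp0 mul1r.
by apply/funext => phi; rewrite /act_slice /= mul0r subr0.
Qed.

Lemma stab_actD v w sigma :
  stab_act (v + w) sigma = stab_act v (stab_act w sigma).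
Proof.
apply: stab_eq => [x|] /=; first by rewrite cexpD mulrA.
apply/funext => phi; rewrite /act_slice /=; congr (slice sigma _).
by rewrite raddfD /= mulrDl opprD addrA.
Qed.

Definition Cprod_act (w : R[i]) (z : Cprod R D) : Cprod R D :=
  fun E => w + z E.

Lemma Cprod_act0 z : Cprod_act 0 z = z.
Proof. by apply/funext => E; rewrite /Cprod_act add0r. Qed.

Lemma Cprod_actD v w z : Cprod_act (v + w) z = Cprod_act v (Cprod_act w z).
Proof. by apply/funext => E; rewrite /Cprod_act addrA. Qed.

Definition stab_orbit := in_orbit stab_act.
Canonical stab_orbit_rel :=
  EquivRelPack (in_orbit_equiv stab_act0 stab_actD : equiv_class_of stab_orbit).

Definition Cprod_orbit := in_orbit Cprod_act.
Canonical Cprod_orbit_rel :=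
  EquivRelPack (in_orbit_equiv Cprod_act0 Cprod_actD : equiv_class_of Cprod_orbit).

Definition stab_mod_C : topologicalType := quotient_topology {eq_quot stab_orbit}.

Definition Cprod_mod_C : topologicalType := quotient_topology {eq_quot Cprod_orbit}.

Definition stab_proj (sigma : stab R D) : stab_mod_C :=
  \pi_{eq_quot stab_orbit} sigma.

Definition Cprod_proj (z : Cprod R D) : Cprod_mod_C :=
  \pi_{eq_quot Cprod_orbit} z.

End CAction.

Arguments stab_mod_C R {k} D.
Arguments Cprod_mod_C R {k} D.

(* Main.v *)
(** If [tau] is closer to [sigma] than half the smallest gap between the
    [sigma]-phases of [E], the [tau]-filtrations of the [sigma]-factors of [E]
    concatenate to the [tau]-filtration of [E], by the octahedral axiom; so
    continuity at [sigma] reduces to [sigma]-semistable objects, whose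
    [tau]-phases all lie near one point.

    Conversely the masses and barycenters of all objects determine the
    semistable objects: equality of masses in a destabilising triangle forces
    all phases involved to agree modulo [2], and the barycenters together with
    the vanishing of maps from higher to lower phases exclude this. Since
    semistable objects generate [K0], the central charge is determined too. *)
From mathcomp Require Import all_boot all_order all_algebra.
From mathcomp Require Import freeg.
From mathcomp Require Import all_classical all_reals all_analysis.
From mathcomp Require Import measurable_realfun complex lra ring.
Require Import Defs.
Import numFieldNormedType.Exports.

Set Implicit Arguments.
Unset Strict Implicit.
Unset Printing Implicit Defensive.

Import Order.TTheory GRing.Theory Num.Theory.

Local Open Scope classical_set_scope.
Local Open Scope quotient_scope.
Local Open Scope ring_scope.

(** * Triangulated categories *)

Section LinCatMore.
Variables (k : fieldType) (C : linCat k).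
Implicit Types X Y Z : C.

Lemma compBl X Y Z (f : hom X Y) (u v : hom Y Z) :
  (u - v) \oc f = u \oc f - v \oc f.
Proof.
have /= := comp_linearl f (-1) v u.
by rewrite !scaleN1r ![- _ + _]addrC.
Qed.

Lemma compBr X Y Z (g : hom Y Z) (u v : hom X Y) :
  g \oc (u - v) = g \oc u - g \oc v.
Proof.
have /= := comp_linearr g (-1) v u.
by rewrite !scaleN1r ![- _ + _]addrC.
Qed.

Lemma comp0m X Y Z (f : hom X Y) : (0 : hom Y Z) \oc f = 0.
Proof. by rewrite -(subrr 0) compBl subrr. Qed.

Lemma compm0 X Y Z (g : hom Y Z) : g \oc (0 : hom X Y) = 0.
Proof. by rewrite -(subrr 0) compBr subrr. Qed.

Lemma compNl X Y Z (f : hom X Y) (u : hom Y Z) : (- u) \oc f = - (u \oc f).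
Proof. by rewrite -[- u]sub0r compBl comp0m sub0r. Qed.

Lemma compNr X Y Z (g : hom Y Z) (u : hom X Y) : g \oc (- u) = - (g \oc u).
Proof. by rewrite -[- u]sub0r compBr compm0 sub0r. Qed.

Lemma hom_to_zero X Y (f : hom X Y) : is_zero Y -> f = 0.
Proof. by move=> Y0; rewrite -[f]comp1m Y0 comp0m. Qed.

Lemma hom_from_zero X Y (f : hom X Y) : is_zero X -> f = 0.
Proof. by move=> X0; rewrite -[f]compm1 X0 compm0. Qed.

Lemma iso_zero X Y : is_zero X -> is_zero Y -> iso X Y.
Proof.
by move=> X0 Y0; exists 0, 0; split; rewrite comp0m; [rewrite X0|rewrite Y0].
Qed.

Lemma zero_iso X Y : iso X Y -> is_zero X -> is_zero Y.
Proof.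
by move=> [f [g [_ fg]]] X0; rewrite /is_zero -fg (hom_from_zero f X0) comp0m.
Qed.

Lemma is_iso_id X : is_iso (idm X).
Proof. by exists (idm X); rewrite comp1m. Qed.

Lemma is_iso_opp_id X : is_iso (- idm X).
Proof. by exists (- idm X); rewrite compNl compNr opprK comp1m. Qed.

End LinCatMore.

Section Triangles.
Variables (k : fieldType) (D : triCat k).
Implicit Types X Y Z W : D.

Lemma shift_hom X Y (f : hom (shift X) (shift Y)) : exists g, shiftm g = f.
Proof. by have [r _ rK] := @shiftm_bij k D X Y; exists (r f). Qed.

Lemma shiftm_inj X Y : injective (@shiftm k D X Y).
Proof. exact: bij_inj (shiftm_bij _ _). Qed.

Lemma dist_rot2 X Y Z (f : hom X Y) (g : hom Y Z) (h : hom Z (shift X)) :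
  dist f g h -> dist h (- shiftm f) (- shiftm g).
Proof. by move=> /dist_rot/dist_rot. Qed.

Lemma dist_comp0 X Y Z (f : hom X Y) (g : hom Y Z) (h : hom Z (shift X)) :
  dist f g h -> g \oc f = 0.
Proof.
move=> d; have [X0 X00] := (tri_additive D).1.
have := dist_id X X00 => d'.
have [|c [+ _]] := @dist_morph _ D _ _ _ _ _ _ _ _ _ _ _ _ (idm X) f d' d.
  by rewrite !compm1.
by rewrite compm0.
Qed.

(** Exactness of [hom W -]: the pair [u], [0] maps the rotated triangle [W -> 0 -> shift W] to the
    rotation of the given one. The third component is the shift of a lift because [shiftm] is
    surjective, and the signs cancel. *)
Lemma dist_lift X Y Z W (f : hom X Y) (g : hom Y Z) (h : hom Z (shift X))
  (u : hom W Y) : dist f g h -> g \oc u = 0 -> exists v, f \oc v = u.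
Proof.
move=> d gu; have [X0 X00] := (tri_additive D).1.
have /dist_rot d' := dist_id W X00.
have /dist_rot d2 := d.
have [|c []] := @dist_morph _ D _ _ _ _ _ _ _ _ _ _ _ _ u (0 : hom X0 Z) d' d2.
  by rewrite comp0m gu.
move=> _; have [v <-] := shift_hom c.
rewrite compNr compNl -!shiftmM => /oppr_inj/shiftm_inj.
by rewrite compm1 => ->; exists v.
Qed.

(** The dual exactness, by comparison with a triangle [Y' -> W -> W] on the identity of [W], where
    [Y'] is zero. *)
Lemma dist_extend X Y Z W (f : hom X Y) (g : hom Y Z) (h : hom Z (shift X))
  (u : hom Y W) : dist f g h -> u \oc f = 0 -> exists v, v \oc g = u.
Proof.
move=> d uf; have [X0 X00] := (tri_additive D).1.
have [Y' [e]] := shift_surj X0; case=> e' [e'e ee'].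
have Y'0 : is_zero Y'.
  apply: shiftm_inj; rewrite shiftm1 -e'e linear0.
  by rewrite (hom_to_zero e X00) compm0.
have d' : dist (0 : hom Y' W) (idm W) (0 : hom W (shift Y')).
  apply/dist_rot; rewrite linear0 oppr0; apply: dist_id.
  by rewrite /is_zero -shiftm1 (Y'0 : idm _ = 0) linear0.
have [|c []] := @dist_morph _ D _ _ _ _ _ _ _ _ _ _ _ _ (0 : hom X Y') u d d'.
  by rewrite comp0m uf.
by rewrite comp1m => <- _; exists c.
Qed.

(** Three rotations shift the triangle and negate all three maps; the isomorphism [- idm] on the
    middle object absorbs two of the signs. *)
Lemma dist_iso_shift X Y Z (f : hom X Y) (g : hom Y Z) (h : hom Z (shift X)) :
  dist (shiftm f) (shiftm g) (- shiftm h) -> dist f g h.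
Proof.
move=> d; do 3 apply/dist_rot.
apply: dist_iso d; [exact: is_iso_id|exact: is_iso_opp_id|exact: is_iso_id| | |].
- by rewrite compm1 compNl comp1m.
- by rewrite comp1m compNl compNr opprK compm1.
- by rewrite shiftm1 comp1m compm1.
Qed.

Lemma dist_cocone Y Z (g : hom Y Z) :
  exists X (f : hom X Y) (h : hom Z (shift X)), dist f g h.
Proof.
have [W [p [q d]]] := dist_cone g; have [X [e ei]] := shift_surj W.
have [e' [e'e ee']] := ei.
have [f fE] := shift_hom (q \oc e).
(* The sign cancels the one that rotation introduces. *)
exists X, (- f), (e' \oc p); apply/dist_rot.
apply: dist_iso d; [exact: is_iso_id|exact: is_iso_id| | | |].
- by exists e; split; [exact: ee'|exact: e'e].
- by rewrite comp1m compm1.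
- by rewrite compm1.
- by rewrite shiftm1 comp1m linearN opprK fE -compA ee' compm1.
Qed.

Lemma dist_isor X Y Y' Z (f : hom X Y) (g : hom Y Z) (h : hom Z (shift X))
    (b : hom Y Y') (b' : hom Y' Y) : b' \oc b = idm Y -> b \oc b' = idm Y' ->
  dist f g h -> dist (b \oc f) (g \oc b') h.
Proof.
move=> b'b bb'; apply: dist_iso; [exact: is_iso_id| |exact: is_iso_id| | |].
- by exists b'; split; [exact: b'b|exact: bb'].
- by rewrite compm1.
- by rewrite comp1m -compA b'b compm1.
- by rewrite shiftm1 comp1m compm1.
Qed.

Lemma zero_shift X : is_zero X -> is_zero (shift X).
Proof. by rewrite /is_zero -shiftm1 => ->; rewrite linear0. Qed.

Lemma dist_zerol_iso X Y Z (f : hom X Y) (g : hom Y Z) (h : hom Z (shift X)) :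
  dist f g h -> is_zero X -> is_iso g.
Proof.
move=> d X0.
have [v vg] : exists v, v \oc g = idm Y.
  by apply: (dist_extend d); rewrite (hom_from_zero f X0) compm0.
exists v; split=> //.
have [u gu] : exists u, g \oc u = idm Z.
  move/dist_rot: d => d; apply: (dist_lift d).
  by rewrite (hom_to_zero h (zero_shift X0)) comp0m.
by rewrite -[v]compm1 -gu [v \oc _]compA vg comp1m gu.
Qed.

Lemma dist_zeror_iso X Y Z (f : hom X Y) (g : hom Y Z) (h : hom Z (shift X)) :
  dist f g h -> is_zero Z -> is_iso f.
Proof.
move=> d Z0.
have [v fv] : exists v, f \oc v = idm Y.
  by apply: (dist_lift d); rewrite (hom_to_zero g Z0) comp0m.
exists v; split=> //.
have [u] : exists u, u \oc - shiftm f = idm (shift X).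
  apply: (dist_extend (dist_rot2 d)).
  by rewrite (hom_from_zero h Z0) compm0.
have [w <-] := shift_hom u.
rewrite compNr -shiftmM -linearN -shiftm1 => /shiftm_inj; rewrite -compNl => wf.
by rewrite -[v]comp1m -wf -[(- w \oc f) \oc v]compA fv compm1 wf.
Qed.

(** If [g] vanishes, the identity of [Z] factors through [h], hence through a map [shift X -> Z]. *)
Lemma dist_zero_cone X Y Z (f : hom X Y) (g : hom Y Z) (h : hom Z (shift X)) :
  dist f g h -> (forall u : hom (shift X) Z, u = 0) -> g = 0 -> is_zero Z.
Proof.
move=> /dist_rot d H g0.
have [u uh] : exists u, u \oc h = idm Z.
  by apply: (dist_extend d); rewrite comp1m.
by rewrite /is_zero -uh (H u) comp0m.
Qed.

(** The first two vanishing hypotheses lift [f] and [f'] through each other; the last two make these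
    lifts unique, hence mutually inverse. *)
Lemma trunc_unique X Y Z X' Z'
    (f : hom X Y) (g : hom Y Z) (h : hom Z (shift X))
    (f' : hom X' Y) (g' : hom Y Z') (h' : hom Z' (shift X')) :
  dist f g h -> dist f' g' h' ->
  (forall u : hom X Z', u = 0) -> (forall u : hom X' Z, u = 0) ->
  (forall u : hom (shift X) Z, u = 0) ->
  (forall u : hom (shift X') Z', u = 0) -> iso X X'.
Proof.
move=> d d' HXZ' HX'Z HXZ HX'Z'.
have [u uE] := dist_lift d' (HXZ' (g' \oc f)).
have [v vE] := dist_lift d (HX'Z (g \oc f')).
(* an endomorphism of the truncation is determined by its composite to [Y] *)
have main (W W' : D) (a : hom W Y) (b : hom Y W') (c : hom W' (shift W))
    (e : hom W W) :
    dist a b c -> (forall w : hom (shift W) W', w = 0) -> a \oc e = a ->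
    e = idm W.
  move=> dd H ae; apply/eqP; rewrite -subr_eq0; apply/eqP/shiftm_inj.
  rewrite linear0.
  have [w <-] : exists w, c \oc w = shiftm (e - idm W).
    apply: (dist_lift (dist_rot2 dd)).
    by rewrite compNl -shiftmM compBr ae compm1 subrr linear0 oppr0.
  by rewrite (H w) compm0.
exists u, v; split; first by apply: (main _ _ _ _ _ _ d HXZ); rewrite compA vE.
by apply: (main _ _ _ _ _ _ d' HX'Z'); rewrite compA uE.
Qed.

(** The octahedral axiom for [Y -> Z -> G], rotated so that it compares the
    fibres of the two maps and of their composite. *)
Lemma dist_octa_cocone A Y Z Z' G
    (a : hom A Y) (b : hom Y Z) (c : hom Z (shift A))
    (f : hom Z' Z) (g : hom Z G) (h : hom G (shift Z')) :
  dist a b c -> dist f g h ->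
  exists Y' (f' : hom Y' Y) (h' : hom G (shift Y'))
    (a' : hom A Y') (b' : hom Y' Z') (c' : hom Z' (shift A)),
    dist f' (g \oc b) h' /\ dist a' b' c'.
Proof.
move=> d1 d2.
have [Y' [f' [h' d3]]] := dist_cocone (g \oc b).
have [u [v [d _ _ _ _]]] := @dist_octa _ D _ _ _ _ _ _ _ _ _ _ _ _ _ _
  (proj1 (dist_rot _ _ _) d1) (proj1 (dist_rot _ _ _) d2)
  (proj1 (dist_rot _ _ _) d3).
exists Y', f', h'.
have [a' a'E] := shift_hom u; have [b' b'E] := shift_hom v.
exists a', b', (c \oc f); split=> //.
by apply: dist_iso_shift; rewrite a'E b'E shiftmM -compNr.
Qed.

End Triangles.

(** * The Grothendieck group: additivity and generation by classes of objects *)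

Section K0More.
Variables (k : fieldType) (D : triCat k).
Implicit Types X Y Z : D.

Lemma cls_dist X Y Z (f : hom X Y) (g : hom Y Z) (h : hom Z (shift X)) :
  dist f g h -> cls Y = cls X + cls Z.
Proof.
move=> d; rewrite /cls -raddfD; apply/eqP.
rewrite -ring_quotient.Quotient.idealrBE opprD addrA unfold_in.
by apply/asboolP => S _ _; apply; exact: d.
Qed.

Lemma cls_zero X : is_zero X -> cls X = 0.
Proof.
move=> X0; have := cls_dist (dist_id X X0).
by move/(congr1 (fun x => x - cls X)); rewrite subrr addrC addrA addNr add0r.
Qed.

Lemma cls_iso X Y : iso X Y -> cls X = cls Y.
Proof.
move=> [f [g [gf fg]]]; have [X0 X00] := (tri_additive D).1.
have := cls_dist (dist_isor gf fg (dist_id X X00)).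
by rewrite (cls_zero X00) addr0 => ->.
Qed.

Lemma K0_ext (V : zmodType) (f g : {additive K0 D -> V}) :
  (forall X, f (cls X) = g (cls X)) -> f =1 g.
Proof.
move=> fg x; rewrite -[x]reprK -[repr x]freeg_sumE !raddf_sum.
apply: eq_bigr => z _.
rewrite (_ : Freeg _ = free_cls z *~ coeff z (repr x)); last first.
  by rewrite /free_cls freegU_mulz intz.
by rewrite !raddfMz /= -/(cls _) fg.
Qed.
End K0More.

(** * Towers of triangles *)

Section Towers.
Variables (k : fieldType) (D : triCat k).
Implicit Types (X Y : D) (s t : seq {classic D}).

Lemma tower_nilE Y : tower Y [::] -> is_zero Y.
Proof.
move Es : [::] => s tY.
by case: tY Es => // X {}Y G [].
Qed.

Lemma tower_rconsE Y G s : tower Y (rcons s G) ->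
  exists X (f : hom X Y) (g : hom Y G) (h : hom G (shift X)),
    tower X s /\ dist f g h.
Proof.
move Es : (rcons s G) => t tY; case: tY Es => [X _ /eqP|].
  by rewrite -size_eq0 size_rcons.
move=> X {}Y G' s' f g h tX d /rcons_inj[ss GG]; subst s' G'.
by exists X, f, g, h.
Qed.

Lemma tower_iso X Y s : iso X Y -> tower X s -> tower Y s.
Proof.
move=> XY; case/lastP: s => [/tower_nilE X0|s G].
  exact/tower_nil/(zero_iso XY X0).
move=> /tower_rconsE[W [f [g [h [tW d]]]]]; have [b [b' [b'b bb']]] := XY.
exact: tower_rcons tW (dist_isor b'b bb' d).
Qed.

(** The fibre [Y] of an identity is zero: [f] vanishes because its composite with the identity does,
    and the identity of [shift Y] factors through [shiftm f]. *)
Lemma tower_seq1 X G : iso G X -> tower X [:: G].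
Proof.
move=> GX; have [X0 X00] := (tri_additive D).1.
apply: tower_iso GX _.
have [Y [f [h d]]] := dist_cocone (idm (G : D)).
rewrite -[[:: G]]/(rcons [::] G); apply: tower_rcons (d); apply: tower_nil.
have /dist_rot d' := d.
have [u] : exists u, u \oc - shiftm f = idm (shift Y).
  by apply: (dist_extend (dist_rot2 d)); rewrite comp1m -[h]compm1 (dist_comp0 d').
have f0 : f = 0 by rewrite -[f]comp1m (dist_comp0 d).
rewrite f0 linear0 oppr0 compm0 -shiftm1 => /esym.
by rewrite -(linear0 shiftm) => /shiftm_inj.
Qed.

Lemma tower_seq1E X G : tower X [:: G] -> iso G X.
Proof.
rewrite -[[:: G]]/(rcons [::] G) => /tower_rconsE[W [f [g [h [/tower_nilE W0 d]]]]].
by apply: iso_sym; exists g; exact: dist_zerol_iso d W0.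
Qed.

Lemma cls_tower X s : tower X s -> cls X = \sum_(G <- s) cls (G : D).
Proof.
elim=> [{}X X0|{s} {}X Y G s f g h _ IH d]; first by rewrite big_nil cls_zero.
by rewrite -cats1 big_cat big_seq1 (cls_dist d) IH.
Qed.

Lemma tower_hom_from X Y s : tower X s ->
  (forall G, G \in s -> forall u : hom (G : D) Y, u = 0) ->
  forall u : hom X Y, u = 0.
Proof.
move=> tX; elim: tX Y => [{}X X0|{s} {}X Z G s f g h _ IH d] Y H u.
  exact: hom_from_zero.
have [v <-] : exists v, v \oc g = u.
  apply: (dist_extend d); apply: IH => G' G's; apply: H.
  by rewrite mem_rcons inE G's orbT.
by rewrite (H G _ v) ?comp0m// mem_rcons mem_head.
Qed.

Lemma tower_hom_shift X Y s : tower X s ->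
  (forall G, G \in s -> forall u : hom (shift (G : D)) Y, u = 0) ->
  forall u : hom (shift X) Y, u = 0.
Proof.
move=> tX H u; have [Z [e [e' [e'e ee']]]] := shift_surj Y.
have [v vE] := shift_hom (e' \oc u).
suff v0 : v = 0 by rewrite -[u]comp1m -ee' -compA -vE v0 linear0 compm0.
apply: (tower_hom_from tX) => G Gs w.
apply: shiftm_inj; rewrite linear0 -[shiftm w]comp1m -e'e -compA.
by rewrite (H G Gs (e \oc _)) compm0.
Qed.

(** Induction on the tower of [B]: the octahedral axiom lifts its last step to a last step of [X],
    leaving a triangle from [A] to the previous stage of [B]. *)
Lemma tower_cat A X B s t (a : hom A X) (b : hom X B) (c : hom B (shift A)) :
  dist a b c -> tower A s -> tower B t -> tower X (s ++ t).
Proof.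
move=> + tA tB; elim: tB X a b c => [{}B B0|{t} Z Z' G t f g h _ IH d] X a b c d'.
  by rewrite cats0; apply: tower_iso tA; exists a; exact: dist_zeror_iso d' B0.
have [Y [f' [h' [a' [b' [c' [d1 d2]]]]]]] := dist_octa_cocone d' d.
by rewrite -rcons_cat; apply: tower_rcons (IH _ _ _ _ d2) d1.
Qed.

End Towers.

(** * Harder-Narasimhan filtrations *)

Section HNUniqueness.
Variables (R : realType) (k : fieldType) (D : triCat k).
Variables (P : R -> D -> Prop) (slP : is_slicing P).
Implicit Types (X Y : D) (s t : seq ({classic D} * R)).

Lemma slice_hom0 phi psi X Y (f : hom X Y) :
  psi < phi -> P phi X -> P psi Y -> f = 0.
Proof. by have [_ + _ _] := slP; apply. Qed.

Lemma slice_shift phi X : P phi X -> P (phi + 1) (shift X).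
Proof.
have [_ _ sh _] := slP => PX; apply/sh; exists X => //; exact: iso_refl.
Qed.

Lemma HN_rcons X s G : is_HN P X (rcons s G) ->
  exists Y (f : hom Y X) (g : hom X G.1) (h : hom (G.1 : D) (shift Y)),
    [/\ is_HN P Y s, dist f g h, ~ is_zero (G.1 : D), P G.2 G.1 &
        forall H, H \in s -> G.2 < H.2].
Proof.
move=> [tX so ss].
have [G0 PG] : ~ is_zero (G.1 : D) /\ P G.2 G.1.
  by apply: ss; rewrite mem_rcons mem_head.
move: tX; rewrite /unzip1 map_rcons => /tower_rconsE[Y [f [g [h [tY d]]]]].
exists Y, f, g, h.
move: so; rewrite /unzip2 map_rcons sorted_pairwise; last first.
  by move=> x y z /= yx zy; exact: lt_trans zy yx.
rewrite pairwise_rcons => /andP[/allP lts so].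
split=> //; last by move=> H Hs; apply: lts; exact: map_f.
split=> //; first by apply: pairwise_sorted.
by move=> H Hs; apply: ss; rewrite mem_rcons inE Hs orbT.
Qed.

Lemma HN_seq1 phi X : ~ is_zero X -> P phi X ->
  is_HN P X [:: (X : {classic D}, phi)].
Proof.
move=> X0 PX; split=> //=; first exact/tower_seq1/iso_refl.
by move=> G; rewrite inE => /eqP ->.
Qed.

Lemma HN_iso X Y s : iso X Y -> is_HN P X s -> is_HN P Y s.
Proof. by move=> XY [tX so ss]; split=> //; exact: tower_iso tX. Qed.

Lemma HN_hom_from X s phi Y : is_HN P X s -> P phi Y ->
  (forall G, G \in s -> phi < G.2) -> forall u : hom X Y, u = 0.
Proof.
move=> [tX _ ss] PY lts; apply: (tower_hom_from tX) => _ /mapP[G Gs ->] u.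
by have [_ PG] := ss _ Gs; exact: slice_hom0 (lts _ Gs) PG PY.
Qed.

Lemma HN_hom_shift X s phi Y : is_HN P X s -> P phi Y ->
  (forall G, G \in s -> phi < G.2 + 1) -> forall u : hom (shift X) Y, u = 0.
Proof.
move=> [tX _ ss] PY lts; apply: (tower_hom_shift tX) => _ /mapP[G Gs ->] u.
by have [_ PG] := ss _ Gs; exact: slice_hom0 (lts _ Gs) (slice_shift PG) PY.
Qed.

(** If [f] were zero, [G.1] would be a retract of [shift Y], whose factors all have phase above
    [G.2], so [G.1] would be zero. *)
Lemma HN_last_neq0 X s G (f : hom X (G.1 : D)) Y (a : hom Y X)
    (h : hom (G.1 : D) (shift Y)) :
  is_HN P Y s -> dist a f h -> ~ is_zero (G.1 : D) -> P G.2 G.1 ->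
  (forall H, H \in s -> G.2 < H.2) -> f <> 0.
Proof.
move=> hY d G0 PG lts f0; apply: G0; apply: dist_zero_cone d _ f0.
apply: HN_hom_shift hY PG _ => H Hs.
by rewrite (lt_trans (lts _ Hs))// ltrDl.
Qed.

Lemma HN_zero X s : is_HN P X s -> is_zero X -> s = [::].
Proof.
case/lastP: s => // s G /HN_rcons[Y [f [g [h [hY d G0 PG lts]]]]] X0.
by have := HN_last_neq0 hY d G0 PG lts; rewrite (hom_from_zero g X0).
Qed.

(** Otherwise every factor of the second filtration has phase above [G.2], which kills the non-zero
    map from [X] to the last factor of the first. *)
Let last_phase_le X s G t H : is_HN P X (rcons s G) -> is_HN P X (rcons t H) ->
  H.2 <= G.2.
Proof.
move=> /HN_rcons[Y [f [g [h [hY d G0 PG lts]]]]] hX; rewrite leNgt.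
apply/negP => GH; apply: (HN_last_neq0 hY d G0 PG lts).
apply: (HN_hom_from hX PG) => K; rewrite mem_rcons inE => /predU1P[->//|Kt].
by have [_ [_ [_ [_ [_ _ _ _ /(_ K Kt)]]]]] := HN_rcons hX; exact: lt_trans.
Qed.

(** The factors are unique only up to isomorphism, so the comparison is made on classes in [K0] and
    phases, which is all that masses and phases depend on. The last phases agree, [trunc_unique]
    then identifies the preceding stages, and induction applies to them. *)
Lemma HN_unique X s t : is_HN P X s -> is_HN P X t ->
  [seq (cls (G.1 : D), G.2) | G <- s] = [seq (cls (G.1 : D), G.2) | G <- t].
Proof.
elim/last_ind: s X t => [|s G IH] X t.
  by move=> [/tower_nilE X0 _ _] /HN_zero ->.
case/lastP: t => [hX [/tower_nilE X0 _ _]|t H hX hX'].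
  by rewrite (HN_zero hX X0).
have GH : G.2 = H.2.
  by apply/eqP; rewrite eq_le (last_phase_le hX hX') (last_phase_le hX' hX).
have [Y [f [g [h [hY d G0 PG lts]]]]] := HN_rcons hX.
have [Y' [f' [g' [h' [hY' d' H0 PH ltt]]]]] := HN_rcons hX'.
have le1 (x y : R) : x < y -> x < y + 1 by move/lt_trans; apply; rewrite ltrDl.
have YY' : iso Y Y'.
  apply: (trunc_unique d d').
  - by apply: (HN_hom_from hY PH) => K Ks; rewrite -GH lts.
  - by apply: (HN_hom_from hY' PG) => K Ks; rewrite GH ltt.
  - by apply: (HN_hom_shift hY PG) => K Ks; apply/le1/lts.
  - by apply: (HN_hom_shift hY' PH) => K Ks; apply/le1/ltt.
rewrite !map_rcons (IH _ _ (HN_iso YY' hY) hY') GH; congr rcons; congr pair.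
move: (cls_dist d) (cls_dist d'); rewrite (cls_iso YY') => ->.
exact: addrI.
Qed.

End HNUniqueness.

(** * Integrals against the mass measure as finite sums *)

Section HNSum.
Variables (R : realType) (k : fieldType) (D : triCat k).
Implicit Types (sigma tau : stab R D) (E F : nzobj D) (f : R -> R).

(** For continuous [f] this is the integral of [f] against the mass measure; [cst 1] gives the mass
    and [id] the numerator of the barycenter. *)
Definition hn_sum sigma f E : R :=
  \sum_(G <- HN sigma E) absZ sigma G.1 * f G.2.

Lemma HN_map_unique sigma (T : Type) (F : K0 D -> R -> T) E s :
  is_HN (slice sigma) (sval E) s ->
  [seq F (cls (G.1 : D)) G.2 | G <- HN sigma E] =
  [seq F (cls (G.1 : D)) G.2 | G <- s].
Proof.
move=> hs; have := HN_unique (slice_slicing sigma) (HNP sigma E) hs.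
by move/(congr1 (map (fun p => F p.1 p.2))); rewrite -!map_comp.
Qed.

Lemma hn_sumE sigma f E s : is_HN (slice sigma) (sval E) s ->
  hn_sum sigma f E = \sum_(G <- s) absZ sigma G.1 * f G.2.
Proof.
move=> /(HN_map_unique (fun c p => ComplexField.Normc.normc (charge sigma c) * f p)).
by move=> /(congr1 (fun s => \sum_(x <- s) x)); rewrite !big_map.
Qed.

Lemma hn_sum_iso sigma f E F : iso (sval E) (sval F) ->
  hn_sum sigma f E = hn_sum sigma f F.
Proof.
move=> EF; rewrite [RHS](@hn_sumE sigma f F (HN sigma E))//.
exact: HN_iso EF (HNP _ _).
Qed.

Lemma hn_sum_slice sigma f E phi : slice sigma phi (sval E) ->
  hn_sum sigma f E = absZ sigma (sval E) * f phi.
Proof.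
move=> PE; rewrite (@hn_sumE _ _ _ [:: (sval E : {classic D}, phi)]) ?big_seq1//.
exact: HN_seq1 (svalP E) PE.
Qed.

Lemma hn_sum_cst sigma c E : hn_sum sigma (cst c) E = mass sigma E * c.
Proof. by rewrite /mass mulr_suml. Qed.

Lemma mass_hn_sum sigma E : mass sigma E = hn_sum sigma (cst 1) E.
Proof. by rewrite hn_sum_cst mulr1. Qed.

Lemma phases_slice sigma E phi : slice sigma phi (sval E) ->
  unzip2 (HN sigma E) = [:: phi].
Proof.
by move=> PE; exact: (HN_map_unique (fun _ p => p) (HN_seq1 (svalP E) PE)).
Qed.

(** The integral splits into positive and negative parts, since the formulas for sums and multiples
    of measures are applied to non-negative functions. *)
Lemma fsm_integral_mass sigma f E : continuous f ->
  fsm_integral f (mass_fsmeasure sigma E) = hn_sum sigma f E.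
Proof.
move=> cf.
have mf : measurable_fun setT (EFin \o f : measurableTypeR R -> \bar R).
  by apply/measurable_EFinP; apply: continuous_measurable_fun.
pose G i := nth (sval E : {classic D}, 0) (HN sigma E) i.
have int_ge0 (g : measurableTypeR R -> \bar R) : measurable_fun setT g ->
    (forall x, 0 <= g x)%E ->
    (\int[mass_measure sigma E]_x g x =
     \sum_(i < size (HN sigma E)) (absZ sigma (G i).1)%:E * g (G i).2)%E.
  move=> mg g0; rewrite ge0_integral_measure_sum//; apply: eq_bigr => i _.
  by rewrite ge0_integral_mscale// integral_dirac// diracT mul1e.
rewrite /fsm_integral /Rintegral /= integralE !int_ge0; last 4 first.
- exact: measurable_funeneg.
- by move=> x; exact: funeneg_ge0.
- exact: measurable_funepos.
- by move=> x; exact: funepos_ge0.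
have pos (i : 'I_(size (HN sigma E))) :
    ((absZ sigma (G i).1)%:E * (EFin \o f)^\+ (G i).2 =
    (absZ sigma (G i).1 * Num.max (f (G i).2) 0)%:E)%E.
  by rewrite funeposE /= -EFin_max.
have neg (i : 'I_(size (HN sigma E))) :
    ((absZ sigma (G i).1)%:E * (EFin \o f)^\- (G i).2 =
    (absZ sigma (G i).1 * Num.max (- f (G i).2) 0)%:E)%E.
  by rewrite funenegE /= -EFin_max.
rewrite (eq_bigr _ (fun i _ => pos i)).
rewrite [X in (_ - X)%E](eq_bigr _ (fun i _ => neg i)).
rewrite !sumEFin -EFinB /= -sumrB /hn_sum.
rewrite (big_nth (sval E : {classic D}, 0)) big_mkord.
apply: eq_bigr => i _; rewrite -mulrBr; congr (_ * _).
by case: (ltgtP (f (G i).2) 0); case: (ltgtP (- f (G i).2) 0); lra.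
Qed.

Lemma log_barycenter_mass sigma E : log_barycenter (mass_fsmeasure sigma E) =
  (ln (mass sigma E) +i* (pi * (hn_sum sigma id E / mass sigma E)))%C.
Proof.
rewrite /log_barycenter !fsm_integral_mass -?mass_hn_sum//.
- by move=> x; exact: cvg_id.
- exact: cst_continuous.
Qed.

(** The coordinates of [ell] see only chosen representatives; invariance under isomorphism carries
    the equalities to every object. Positivity of the mass allows [ln] and the division to be
    undone. *)
Lemma ell_eq_hn_sum sigma tau : ell sigma = ell tau ->
  forall E, mass sigma E = mass tau E /\ hn_sum sigma id E = hn_sum tau id E.
Proof.
move=> st E; pose F := repr (\pi_(isoclass D) E).
have FE : iso (sval F) (sval E).
  have : \pi_(isoclass D) F == \pi_(isoclass D) E by rewrite reprK.
  by rewrite eqmodE => /asboolP.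
move: (congr1 (fun z => z (\pi E)) st); rewrite /ell /dm -/F.
rewrite !log_barycenter_mass => -[/ln_inj mE /mulfI bE].
have {}mE : mass sigma F = mass tau F by apply: mE; rewrite posrE mass_gt0.
split; first by rewrite !mass_hn_sum -!(hn_sum_iso _ _ FE) -!mass_hn_sum.
rewrite -!(hn_sum_iso _ _ FE); have := bE (lt0r_neq0 (pi_gt0 R)).
by rewrite mE => /mulIf; apply; rewrite invr_eq0 gt_eqF ?mass_gt0.
Qed.

(** Acting by [w] multiplies masses by the exponential of its real part and translates phases by its
    imaginary part over [pi], so each coordinate moves by exactly [w]. *)
Lemma ell_act w sigma : ell (stab_act w sigma) = Cprod_act w (ell sigma).
Proof.
apply/funext => C; rewrite /ell /dm /Cprod_act; move: (repr C) => {C} E.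
pose t (G : {classic D} * R) := (G.1, G.2 + complex.Im w / pi).
have absw X : absZ (stab_act w sigma) X = expR (complex.Re w) * absZ sigma X.
  by rewrite /absZ /= ComplexField.Normc.normcM cexp_norm.
have hE f : hn_sum (stab_act w sigma) f E =
    expR (complex.Re w) * hn_sum sigma (fun x => f (x + complex.Im w / pi)) E.
  rewrite (@hn_sumE _ _ _ (map t (HN sigma E))).
    by rewrite big_map mulr_sumr; apply: eq_bigr => G _; rewrite absw mulrA.
  have [tw so ss] := HNP sigma E; split.
  - by rewrite /unzip1 -map_comp; exact: tw.
  - move: so; rewrite /unzip2 -map_comp !sorted_map; apply: sub_sorted.
    by move=> x y /=; rewrite ltrD2r.
  - by move=> _ /mapP[G Gs ->] /=; rewrite /act_slice addrK; exact: ss.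
have e0 := expR_gt0 (complex.Re w).
have m0 := mass_gt0 sigma E.
have mE : mass (stab_act w sigma) E = expR (complex.Re w) * mass sigma E.
  by rewrite !mass_hn_sum hE.
have bE : hn_sum (stab_act w sigma) id E = expR (complex.Re w) *
    (hn_sum sigma id E + mass sigma E * (complex.Im w / pi)).
  rewrite hE; congr (_ * _); rewrite mulr_suml -big_split.
  by apply: eq_bigr => G _; rewrite mulrDr.
rewrite !log_barycenter_mass mE bE lnM ?posrE// expRK.
apply/eqP; rewrite eq_complex; case: (w) e0 => a b /= e0; rewrite eqxx /=; apply/eqP.
clear -e0 m0; move: (lt0r_neq0 (pi_gt0 R)); move: pi => p p0.
by field; rewrite p0 !gt_eqF.
Qed.

End HNSum.

(** * Injectivity *)

Section Injectivity.
Variables (R : realType) (k : fieldType) (D : triCat k).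
Implicit Types (sigma tau : stab R D) (E F : nzobj D).

Lemma HN_last sigma E : exists s G, HN sigma E = rcons s G.
Proof.
by case/lastP: (HN sigma E) (HN_neq0 sigma E) => // s G _; exists s, G.
Qed.

Lemma absZ_slice_gt0 sigma phi X :
  slice sigma phi X -> ~ is_zero X -> 0 < absZ sigma X.
Proof.
move=> PX X0; have [r r0] := charge_slice PX X0.
rewrite /absZ => ->; rewrite ComplexField.Normc.normcM cexp_norm /= expR0 mulr1.
by rewrite expr0n /= addr0 sqrtr_sqr gtr0_norm.
Qed.

Lemma charge_sliceE sigma phi X : slice sigma phi X -> ~ is_zero X ->
  charge sigma (cls X) = (absZ sigma X)%:C%C * cexp (0 +i* (pi * phi))%C.
Proof.
move=> PX X0; have [r r0 rE] := charge_slice PX X0.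
suff -> : absZ sigma X = r by [].
rewrite /absZ rE ComplexField.Normc.normcM cexp_norm /= expR0 mulr1.
by rewrite expr0n /= addr0 sqrtr_sqr gtr0_norm.
Qed.

(** The left side is additive on triangles, which masses are not; the right side is comparable with
    the mass term by term. *)
Lemma charge_rot sigma phi E :
  complex.Re (charge sigma (cls (sval E)) * cexp (0 +i* (- (pi * phi)))%C) =
  hn_sum sigma (fun x => cos (pi * (x - phi))) E.
Proof.
have [tw _ ss] := HNP sigma E.
rewrite /hn_sum (cls_tower tw) raddf_sum big_map mulr_suml raddf_sum !big_seq.
apply: eq_bigr => G /ss[G0 PG].
rewrite (charge_sliceE PG G0) -mulrA -cexpD /cexp /= addr0 expR0.
by rewrite !mul1r !mul0r !subr0 -mulrBr.
Qed.

Lemma hn_cos_le sigma phi E :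
  hn_sum sigma (fun x => cos (pi * (x - phi))) E <= mass sigma E.
Proof.
by apply: ler_sum => G _; rewrite ler_piMr ?absZ_ge0 ?cos_le1.
Qed.

Lemma hn_cos_eq sigma phi E :
  hn_sum sigma (fun x => cos (pi * (x - phi))) E = mass sigma E ->
  forall G, G \in HN sigma E -> cos (pi * (G.2 - phi)) = 1.
Proof.
move=> /esym/eqP; rewrite -subr_eq0 -sumrB => /eqP s0 G Gs.
have ge0 H : H \in HN sigma E ->
    0 <= absZ sigma H.1 - absZ sigma H.1 * cos (pi * (H.2 - phi)).
  by move=> _; rewrite subr_ge0 ler_piMr ?absZ_ge0 ?cos_le1.
move: s0; rewrite big_seq => /eqP; rewrite psumr_eq0// => /allP/(_ _ Gs).
rewrite Gs /= -{1}[absZ _ _]mulr1 -mulrBr mulf_eq0 gt_eqF ?(absZ_gt0 Gs)//=.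
by rewrite subr_eq0 => /eqP.
Qed.

(** The rotated real part of the charge is additive, at most the mass, and equal to it for the
    semistable [E]. Additivity of the masses therefore forces equality for [A] and [B], hence for
    each of their factors. *)
Lemma mass_triangle_eq sigma phi E A B (f : hom (sval A) (sval E))
    (g : hom (sval E) (sval B)) (h : hom (sval B) (shift (sval A))) :
  slice sigma phi (sval E) -> dist f g h ->
  mass sigma E = mass sigma A + mass sigma B ->
  forall G, G \in HN sigma A ++ HN sigma B -> cos (pi * (G.2 - phi)) = 1.
Proof.
move=> PE d mE.
have cE : hn_sum sigma (fun x => cos (pi * (x - phi))) E = mass sigma E.
  by rewrite mass_hn_sum !(hn_sum_slice _ PE) subrr mulr0 cos0.
have : hn_sum sigma (fun x => cos (pi * (x - phi))) E =
    hn_sum sigma (fun x => cos (pi * (x - phi))) A +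
    hn_sum sigma (fun x => cos (pi * (x - phi))) B.
  by rewrite -!charge_rot (cls_dist d) raddfD mulrDl raddfD.
rewrite cE mE => sumE.
have leA := hn_cos_le sigma phi A; have leB := hn_cos_le sigma phi B.
by move=> G; rewrite mem_cat => /orP[]; apply: hn_cos_eq; lra.
Qed.

(** If the last step [A -> E -> B] of the [tau]-filtration of a
    [sigma]-semistable [E] were proper, equality of masses would put all
    [sigma]-phases of [A] and [B] in [phi + 2Z], equality of barycenters
    would put the lowest one [b] of [B] below [phi], and then the vanishing of
    maps from [E] to the lowest factors would force [b = a + 1] for the lowest
    phase [a] of [A]. *)
Lemma slice_transfer sigma tau phi X :
  (forall E, mass sigma E = mass tau E /\ hn_sum sigma id E = hn_sum tau id E) ->
  slice sigma phi X -> slice tau phi X.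
Proof.
move=> st PX; have [X0|X0] := pselect (is_zero X).
  have [add _ _ _] := slice_slicing tau.
  have [Piso [[[Z PZ] Z0] _]] := add phi.
  by apply: Piso (PZ); apply: iso_zero X0; exact: Z0.
pose E : nzobj D := exist _ X X0; have PE : slice sigma phi (sval E) by [].
have [s [G sG]] := HN_last tau E.
have := HNP tau E; rewrite sG => hE.
have [Y [f [g [h [hY d G0 PG lts]]]]] := HN_rcons hE.
have mphi : mass tau E * phi = hn_sum tau id E.
  by have [<- <-] := st E; rewrite mass_hn_sum !(hn_sum_slice _ PE) /= mulr1.
have [Y0|Y0] := pselect (is_zero Y).
  have s0 := HN_zero (slice_slicing tau) hY Y0; subst s.
  have [tE _ _] := hE; have GX := tower_seq1E tE.
  have [add _ _ _] := slice_slicing tau.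
  have [Piso _] := add G.2; have PEt : slice tau G.2 (sval E) := Piso _ _ GX PG.
  suff -> : phi = G.2 by [].
  move: mphi; rewrite mass_hn_sum !(hn_sum_slice _ PEt) mulr1.
  apply: mulfI; rewrite gt_eqF//.
  by have := mass_gt0 tau E; rewrite mass_hn_sum (hn_sum_slice _ PEt) mulr1.
exfalso.
pose A : nzobj D := exist _ Y Y0; pose B : nzobj D := exist _ (G.1 : D) G0.
have addE w : hn_sum tau w E = hn_sum tau w A + hn_sum tau w B.
  rewrite (hn_sumE w (HNP tau E)) sG (@hn_sumE _ _ _ _ w A _ hY).
  by rewrite (@hn_sum_slice _ _ _ _ _ B _ PG) -cats1 big_cat big_seq1.
have mE : mass tau E = mass tau A + mass tau B by rewrite !mass_hn_sum addE.
have mB := mass_gt0 sigma B.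
have hB : hn_sum tau id B = mass tau B * G.2.
  by rewrite mass_hn_sum !(@hn_sum_slice _ _ _ _ _ B _ PG) mulr1.
(* [phi] is the barycenter of the [tau]-phases of [E], of which [G.2] is the lowest and not the only
   one. *)
have ltG : G.2 < phi.
  have hA : mass tau A * G.2 < hn_sum tau id A.
    rewrite -hn_sum_cst !(@hn_sumE _ _ _ _ _ A _ hY).
    have sn : s != [::].
      by apply/eqP => s0; have [] := hY; rewrite s0 => /tower_nilE.
    case: s sn hY lts {hE sG} => // H s _ [_ _ ss] lts.
    have absH K : K \in H :: s -> 0 < absZ tau K.1.
      by move=> /ss[K0 PK]; exact: absZ_slice_gt0 PK K0.
    rewrite !big_cons; apply: ltr_leD.
      by rewrite ltr_pM2l ?absH ?lts ?mem_head.
    rewrite !big_seq; apply: ler_sum => K Ks.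
    have KHs : K \in H :: s by rewrite inE Ks orbT.
    by rewrite ler_pM2l ?absH ?KHs//= ltW// lts.
  rewrite -(ltr_pM2l (mass_gt0 tau E)) mphi addE mE hB mulrDl.
  by rewrite ltrD2r.
have [sA [GA sAE]] := HN_last sigma A; have [sB [GB sBE]] := HN_last sigma B.
have := HNP sigma A; have := HNP sigma B; rewrite sAE sBE => hBs hAs.
have [YB [fB [p [hB' [hYB dB GB0 PGB ltB]]]]] := HN_rcons hBs.
have [YA [fA [q [hA' [hYA dA GA0 PGA ltA]]]]] := HN_rcons hAs.
have slS := slice_slicing sigma.
have leA K : K \in rcons sA GA -> GA.2 <= K.2.
  by rewrite mem_rcons inE => /predU1P[->//|/ltA/ltW].
have leB K : K \in rcons sB GB -> GB.2 <= K.2.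
  by rewrite mem_rcons inE => /predU1P[->//|/ltB/ltW].
(* Otherwise the [sigma]-barycenter of [B] would be at least [phi], while it equals its
   [tau]-barycenter [G.2]. *)
have GBphi : GB.2 < phi.
  rewrite ltNge; apply/negP => le.
  have : mass sigma B * phi <= hn_sum sigma id B.
    rewrite -hn_sum_cst /hn_sum sBE !big_seq; apply: ler_sum => K Ks.
    by rewrite ler_wpM2l ?absZ_ge0//= (le_trans le)// leB.
  have [mBst ->] := st B.
  by rewrite hB -mBst ler_pM2l// leNgt ltG.
(* The projection [p] of [B] to its lowest factor kills [g], so it factors through [shift (sval A)],
   whose phases would exceed [GB.2]. *)
have le1 : GA.2 + 1 <= GB.2.
  rewrite leNgt; apply/negP => lt1.
  apply: (HN_last_neq0 slS hYB dB GB0 PGB ltB).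
  have [v <-] : exists v, v \oc h = p.
    apply: (dist_extend (proj1 (dist_rot _ _ _) d)).
    exact: slice_hom0 slS _ _ _ _ (p \oc g) GBphi PE PGB.
  rewrite (HN_hom_shift slS hAs PGB _ v) ?comp0m// => K Ks.
  by rewrite (lt_le_trans lt1)// lerD2r leA.
(* Dually, the shifted projection [q] of [A] would kill [h], so [q] would extend along [f] up to
   sign to a map from [E], zero because [GA.2 < phi]. *)
have le2 : GB.2 <= GA.2 + 1.
  rewrite leNgt; apply/negP => lt2.
  apply: (HN_last_neq0 slS hYA dA GA0 PGA ltA).
  have [v vE] : exists v, v \oc (- shiftm f) = shiftm q.
    apply: (dist_extend (dist_rot2 d)).
    apply: (HN_hom_from slS hBs (slice_shift slS PGA)) => K Ks.
    by rewrite (lt_le_trans lt2)// leB.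
  have [w wv] := shift_hom v.
  have w0 : w = 0 by apply: (slice_hom0 slS w _ PE PGA); lra.
  by apply: shiftm_inj; rewrite -vE -wv w0 !linear0 comp0m.
have mEs : mass sigma E = mass sigma A + mass sigma B.
  by have [-> _] := st E; have [-> _] := st A; have [-> _] := st B.
have cos1 := @mass_triangle_eq sigma phi E A B f g h PE d mEs.
have cA : cos (pi * (GA.2 - phi)) = 1.
  by apply: cos1; rewrite mem_cat sAE mem_rcons mem_head.
have cB : cos (pi * (GB.2 - phi)) = 1.
  by apply: cos1; rewrite mem_cat sBE mem_rcons mem_head orbT.
(* The two arguments of the cosine differ by [pi], so both values cannot be [1]. *)
have GBE : GB.2 - phi = GA.2 - phi + 1 by lra.
move: cB; rewrite GBE mulrDr mulr1 cosDpi cA => /eqP.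
by rewrite lt_eqF// ltrN10.
Qed.

(** The slices agree by [slice_transfer] in both directions. On a semistable factor the phase and
    the mass give the charge, and such factors generate [K0]. *)
Lemma ell_inj : injective (@ell R k D).
Proof.
move=> sigma tau /ell_eq_hn_sum st.
have ts E : mass tau E = mass sigma E /\ hn_sum tau id E = hn_sum sigma id E.
  by have [-> ->] := st E.
apply: stab_eq; last first.
  apply/funext => phi; apply/funext => X; apply/propext.
  by split; apply: slice_transfer.
apply: K0_ext => X; have [X0|X0] := pselect (is_zero X).
  by rewrite (cls_zero X0) !raddf0.
have [tw _ ss] := HNP sigma (exist _ X X0).
rewrite (cls_tower tw) !raddf_sum !big_seq; apply: eq_bigr => _ /mapP[G Gs ->].
have [G0 PG] := ss _ Gs; have PGt := slice_transfer st PG.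
rewrite (charge_sliceE PG G0) (charge_sliceE PGt G0); congr (_%:C%C * _).
pose F : nzobj D := exist _ (G.1 : D) G0; have [+ _] := st F.
rewrite !mass_hn_sum (@hn_sum_slice _ _ _ sigma _ F _ PG).
by rewrite (@hn_sum_slice _ _ _ tau _ F _ PGt) !mulr1.
Qed.

End Injectivity.

(** * Continuity *)

Section Topology.

Lemma cvg_initial (S : choiceType) (T : topologicalType) (g : S -> T)
    (F : set_system S) (x : S) : Filter F ->
  g @ F --> g x -> F --> (x : initial_topology g).
Proof.
move=> FF Fgx U; rewrite /= nbhsE => -[B [[C oC <-] Cx] /filterS]; apply.
by apply: Fgx; exact: open_nbhs_nbhs.
Qed.

Lemma cvg_complex (R : realType) (T : Type) (F : set_system T) (a b : T -> R)
    (x y : R) : Filter F -> a @ F --> x -> b @ F --> y ->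
  (fun t => (a t +i* b t)%C : R[i]^o) @ F --> ((x +i* y)%C : R[i]^o).
Proof.
(* A positive complex number has zero imaginary part, so the radius is real. *)
move=> FF ax by_; apply/cvgrPdist_lt => -[e e']; rewrite ltcE /= => /andP[/eqP-> e0].
have e20 : 0 < e / 2 by rewrite divr_gt0.
move/cvgrPdist_lt : ax => /(_ _ e20); move/cvgrPdist_lt : by_ => /(_ _ e20).
apply: filterS2 => t; rewrite !ltr_norml => /andP[b1 b2] /andP[a1 a2].
rewrite normc_def ltcR /= -[e]gtr0_norm// -sqrtr_sqr ltr_sqrt ?exprn_gt0//.
by nra.
Qed.
End Topology.

(** * Refining filtrations under small deformations *)

Section Refinement.
Variables (R : realType) (k : fieldType) (D : triCat k).
Implicit Types (sigma tau : stab R D) (E F : nzobj D).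

Lemma tower_flatten (r : {classic D} -> seq {classic D}) (X : D) s :
  tower X s -> (forall G, G \in s -> tower (G : D) (r G)) ->
  tower X (flatten (map r s)).
Proof.
elim=> [{}X X0 _|{s} {}X Z G s f g h _ IH d H]; first exact: tower_nil.
rewrite map_rcons -cats1 flatten_cat /= cats0.
apply: tower_cat d (IH _) (H _ _); last by rewrite mem_rcons mem_head.
by move=> K Ks; apply: H; rewrite mem_rcons inE Ks orbT.
Qed.

Lemma sorted_gap (l : seq R) : sorted (fun x y => y < x) l ->
  exists2 e, 0 < e & pairwise (fun x y => y + e <= x) l.
Proof.
elim: l => [|x [|y l] IH] /=; [by exists 1|by exists 1|].
move=> /andP[yx yl]; have [e e0 /= /andP[el pl]] := IH yl.
exists (Num.min e (x - y)); first by rewrite lt_min e0 subr_gt0.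
have le1 : Num.min e (x - y) <= e by rewrite ge_min lexx.
have le2 : Num.min e (x - y) <= x - y by rewrite ge_min lexx orbT.
have le3 z : z \in l -> z + e <= y by move/(allP el).
apply/and3P; split.
- rewrite -lerBrDl le2 /=; apply/allP => z /le3; lra.
- by apply/allP => z /le3; lra.
- by apply: sub_pairwise pl => a b; lra.
Qed.

Lemma phase_between sigma E psi : psi \in unzip2 (HN sigma E) ->
  phi_minus sigma E <= psi <= phi_plus sigma E.
Proof.
have [_ so _] := HNP sigma E; rewrite /phi_minus /phi_plus.
have {}so : sorted >=%R (unzip2 (HN sigma E)).
  by apply: sub_sorted so => x y /ltW.
case: (unzip2 _) so => // x l /= pl; rewrite inE.
have xl : all (fun z => z <= x) l.
  by apply: order_path_min pl => a b c /= ba cb; exact: le_trans cb ba.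
have lastle : forall z, z \in x :: l -> last x l <= z.
  elim: l x pl {xl} => [|y l IH] x /=; first by move=> _ z; rewrite inE => /eqP->.
  move=> /andP[yx pl] z; rewrite inE => /predU1P[->|]; last exact: IH.
  by rewrite (le_trans _ yx)// IH// mem_head.
move=> zl; rewrite lastle ?inE//=.
by case/predU1P: zl => [->//|/(allP xl)].
Qed.

Lemma stab_ballP sigma tau e E : stab_ball sigma e tau ->
  [/\ `|phi_plus sigma E - phi_plus tau E| < e,
      `|phi_minus sigma E - phi_minus tau E| < e &
      `|ln (mass sigma E) - ln (mass tau E)| < e].
Proof.
move=> b; have [p m l] := stab_dist_ge sigma tau E.
split; rewrite -lte_fin; [exact: le_lt_trans p b|exact: le_lt_trans m b|].
by rewrite distrC -ln_mass_dist; exact: le_lt_trans l b.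
Qed.

Lemma phase_near sigma tau e E phi psi : stab_ball sigma e tau ->
  slice sigma phi (sval E) -> psi \in unzip2 (HN tau E) -> `|psi - phi| < e.
Proof.
move=> /(@stab_ballP _ _ _ E)[+ + _] PE /phase_between/andP[].
rewrite {1}/phi_plus {1}/phi_minus (phases_slice PE) /= !ltr_norml.
by move=> /andP[? ?] /andP[? ?] ? ?; apply/andP; split; lra.
Qed.

(** The extension of [HN] to zero objects lets filtrations be indexed by bare objects, without a
    proof that each is non-zero. *)
Definition HN0 sigma (X : D) : seq ({classic D} * R) :=
  match pselect (is_zero X) with
  | left _ => [::]
  | right X0 => HN sigma (exist _ X X0)
  end.

Lemma HN0E sigma E : HN0 sigma (sval E) = HN sigma E.
Proof.
rewrite /HN0; case: E => X X0 /=; case: pselect => // X0'.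
by rewrite (Prop_irrelevance X0 X0').
Qed.

Lemma HN0P sigma X : is_HN (slice sigma) X (HN0 sigma X).
Proof.
rewrite /HN0; case: pselect => X0; first by split; first exact: tower_nil.
exact: HNP (exist _ X X0).
Qed.

(** Blocks of phases within [e / 2] of centres at least [e] apart cannot overlap. *)
Lemma sorted_flatten_gap (e : R) (s : seq ({classic D} * R))
    (r : {classic D} -> seq ({classic D} * R)) :
  pairwise (fun x y => y + e <= x) (unzip2 s) ->
  (forall G, G \in s -> sorted (fun x y => y < x) (unzip2 (r G.1)) /\
     forall psi, psi \in unzip2 (r G.1) -> `|psi - G.2| < e / 2) ->
  pairwise (fun x y => y < x) (unzip2 (flatten [seq r G.1 | G <- s])).
Proof.
elim: s => // G s IH /= /andP[/allP Gs ps] H.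
rewrite /unzip2 map_cat pairwise_cat; apply/and3P; split.
- apply/allrelP => x y xG /mapP[K /flatten_mapP[L Ls KL] ->].
  have [_ /(_ _ xG)] := H _ (mem_head _ _).
  have [|_ /(_ K.2)] := H L; first by rewrite inE Ls orbT.
  move=> /(_ (map_f _ KL)); have := Gs L.2 (map_f _ Ls).
  rewrite !ltr_norml => ? /andP[? ?] /andP[? ?]; lra.
- have [+ _] := H _ (mem_head _ _); rewrite sorted_pairwise//.
  by move=> x y z /= yx zy; exact: lt_trans zy yx.
- by apply: IH => // K Ks; apply: H; rewrite inE Ks orbT.
Qed.

Lemma near_stab_ball sigma (e : R) : 0 < e ->
  \forall tau \near sigma, stab_ball sigma e tau.
Proof. exact: (@near_ball R (stab R D) sigma e). Qed.

(** The neighbourhood depends only on the phase gap [e], not on [f]: there the concatenated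
    [tau]-filtrations of the factors form a [tau]-filtration of [E]. *)
Lemma near_refine sigma E : \forall tau \near sigma, forall f,
  hn_sum tau f E = \sum_(G <- HN sigma E)
    \sum_(H <- HN0 tau (G.1 : D)) absZ tau H.1 * f H.2.
Proof.
have [tw so ss] := HNP sigma E.
have [e e0 pe] := sorted_gap so.
have e20 : 0 < e / 2 by rewrite divr_gt0.
near=> tau; move=> f.
have bt : stab_ball sigma (e / 2) tau by near: tau; exact: near_stab_ball.
rewrite (@hn_sumE _ _ _ tau f E (flatten [seq HN0 tau (G.1 : D) | G <- HN sigma E])).
  by rewrite big_flatten big_map.
split.
- have -> : unzip1 (flatten [seq HN0 tau (G.1 : D) | G <- HN sigma E]) =
      flatten [seq unzip1 (HN0 tau (X : D)) | X <- unzip1 (HN sigma E)].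
    by rewrite /unzip1 map_flatten -!map_comp.
  by apply: tower_flatten tw _ => X _; have [] := HN0P tau X.
- apply: pairwise_sorted; apply: sorted_flatten_gap pe _ => G Gs.
  have [G0 PG] := ss _ Gs; split; first by have [] := HN0P tau (G.1 : D).
  pose F : nzobj D := exist _ (G.1 : D) G0 => psi.
  rewrite (HN0E tau F); exact: (@phase_near sigma tau _ F).
- move=> K KF; have [G _ KG] :=
    @flatten_mapP _ _ (fun G : {classic D} * R => HN0 tau (G.1 : D)) _ _ KF.
  by have [_ _] := HN0P tau (G.1 : D); exact.
Unshelve. all: by end_near. Qed.

(** The metric bounds differences of logarithms of masses; exponentiating gives the masses. *)
Lemma mass_cvg sigma E : mass tau E @[tau --> sigma] --> mass sigma E.
Proof.
have FF := @nbhs_filter (stab R D) sigma.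
have lnc : ln (mass tau E) @[tau --> sigma] --> ln (mass sigma E).
  apply/cvgrPdist_lt => e e0; near=> tau.
  have bt : stab_ball sigma e tau by near: tau; exact: near_stab_ball.
  by have [] := stab_ballP E bt.
have -> : (fun tau => mass tau E) = expR \o (fun tau => ln (mass tau E)).
  by apply/funext => tau /=; rewrite lnK// posrE mass_gt0.
have <- : expR (ln (mass sigma E)) = mass sigma E by rewrite lnK// posrE mass_gt0.
exact: continuous_cvg (@continuous_expR R _) lnc.
Unshelve. all: by end_near. Qed.

(** The sum is [mass tau F * f phi] plus an error, which is small because all [tau]-phases of [F]
    approach [phi] and [f] is continuous there. *)
Lemma hn_sum_slice_cvg sigma phi F (f : R -> R) : slice sigma phi (sval F) ->
  continuous f -> hn_sum tau f F @[tau --> sigma] --> absZ sigma (sval F) * f phi.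
Proof.
move=> PF cf; have FF := @nbhs_filter (stab R D) sigma; rewrite -(hn_sum_slice _ PF).
have mF : hn_sum sigma f F = mass sigma F * f phi + 0.
  by rewrite mass_hn_sum !(hn_sum_slice _ PF) mulr1 addr0.
have -> : (fun tau => hn_sum tau f F) = (fun tau =>
    mass tau F * f phi + (hn_sum tau f F - mass tau F * f phi)).
  by apply/funext => tau; rewrite subrKC.
rewrite mF; apply: cvgD; first by apply: cvgM; [exact: mass_cvg|exact: cvg_cst].
(* The added [1] makes [m] a strict bound on the masses near [sigma], so a variation of [f] of at
   most [e / m] contributes less than [e]. *)
apply/cvgr0Pnorm_lt => e e0; pose m := mass sigma F + 1.
have m0 : 0 < m by rewrite addr_gt0// mass_gt0.
have em0 : 0 < e / m by rewrite divr_gt0.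
have /cvgrPdist_lt/(_ _ em0)/nbhs_ballP[d /= d0 fd] := cf phi.
have mlt : \forall tau \near sigma, mass tau F < m.
  by apply: (cvgr_lt _ (@mass_cvg sigma F)); rewrite ltrDl.
near=> tau.
have mt : mass tau F < m by near: tau.
have bt : stab_ball sigma d tau by near: tau; exact: near_stab_ball.
rewrite -hn_sum_cst /hn_sum -sumrB.
apply: (@le_lt_trans _ _ (mass tau F * (e / m))); last first.
  by rewrite mulrA ltr_pdivrMr// mulrC ltr_pM2l.
rewrite mulr_suml; apply: le_trans (ler_norm_sum _ _ _) _.
rewrite !big_seq; apply: ler_sum => G Gs.
rewrite -mulrBr normrM ger0_norm ?absZ_ge0// ler_wpM2l ?absZ_ge0// distrC ltW//.
by apply: fd; rewrite /ball /= distrC; apply: (phase_near bt PF); exact: map_f.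
Unshelve. all: by end_near. Qed.

Lemma hn_sum_cvg sigma E (f : R -> R) : continuous f ->
  hn_sum tau f E @[tau --> sigma] --> hn_sum sigma f E.
Proof.
move=> cf; have FF := @nbhs_filter (stab R D) sigma; have [_ _ ss] := HNP sigma E.
apply: (@cvg_trans _ ((fun tau => \sum_(G <- HN sigma E)
    \sum_(H <- HN0 tau (G.1 : D)) absZ tau H.1 * f H.2) @ sigma)).
  apply: near_eq_cvg; near=> tau; apply/esym.
  by have /= -> := near (near_refine sigma E) tau _ f.
rewrite /hn_sum !big_seq.
under eq_fun do rewrite big_seq.
apply: (@cvg_big _ _ _ _ _ (@add_continuous R) _ _ _ _ _ FF) => G Gs.
have [G0 PG] := ss _ Gs.
pose F : nzobj D := exist _ (G.1 : D) G0.
under eq_fun do rewrite (HN0E _ F).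
exact: (@hn_sum_slice_cvg sigma G.2 F).
Unshelve. all: by end_near. Qed.

(** The product and weak topologies are both suprema of initial topologies, so one coordinate and
    one test function are treated at a time. *)
Lemma dm_continuous : continuous (@dm R k D).
Proof.
move=> sigma; have FF := @nbhs_filter (stab R D) sigma.
apply/cvg_sup => C; apply: cvg_initial.
apply/cvg_sup => -[f cf]; apply: cvg_initial.
rewrite -[X in X --> _]/
  (fsm_integral f (mass_fsmeasure tau (repr C)) @[tau --> sigma]).
under eq_fun do rewrite fsm_integral_mass//.
by rewrite /= /dm fsm_integral_mass//; exact: hn_sum_cvg.
Qed.

Lemma ell_continuous : continuous (@ell R k D).
Proof.
move=> sigma; have FF := @nbhs_filter (stab R D) sigma.
apply/cvg_sup => C; apply: cvg_initial.
rewrite -[X in X --> _]/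
  (log_barycenter (mass_fsmeasure tau (repr C)) @[tau --> sigma]).
under eq_fun do rewrite log_barycenter_mass.
rewrite /= /ell /dm log_barycenter_mass.
have m0 := mass_gt0 sigma (repr C).
apply: cvg_complex.
  exact: continuous_cvg (continuous_ln m0) (@mass_cvg _ _).
apply: cvgM; first exact: cvg_cst.
apply: cvgM; first by apply: hn_sum_cvg => x; exact: cvg_id.
by apply: cvgV; [rewrite gt_eqF|exact: mass_cvg].
Qed.

End Refinement.

(** * Passage to the orbit spaces *)

Section Quotient.
Variables (R : realType) (k : fieldType) (D : triCat k).

Lemma stab_projP (sigma tau : stab R D) :
  stab_proj sigma = stab_proj tau <-> exists w, tau = stab_act w sigma.
Proof.
split=> [e|[w e]].
- have /eqP : \pi_{eq_quot (@stab_orbit R k D)} sigma =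
              \pi_{eq_quot (@stab_orbit R k D)} tau by exact: e.
  by rewrite eqmodE => /asboolP.
- suff : \pi_{eq_quot (@stab_orbit R k D)} sigma =
         \pi_{eq_quot (@stab_orbit R k D)} tau by [].
  by apply/eqP; rewrite eqmodE; apply/asboolP; exists w.
Qed.

Lemma Cprod_projP (y z : Cprod R D) :
  Cprod_proj y = Cprod_proj z <-> exists w, z = Cprod_act w y.
Proof.
split=> [e|[w e]].
- have /eqP : \pi_{eq_quot (@Cprod_orbit R k D)} y =
              \pi_{eq_quot (@Cprod_orbit R k D)} z by exact: e.
  by rewrite eqmodE => /asboolP.
- suff : \pi_{eq_quot (@Cprod_orbit R k D)} y =
         \pi_{eq_quot (@Cprod_orbit R k D)} z by [].
  by apply/eqP; rewrite eqmodE; apply/asboolP; exists w.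
Qed.

Definition ell_mod_C (x : stab_mod_C R D) : Cprod_mod_C R D :=
  Cprod_proj (ell (repr x)).

(** The chosen representative lies in the orbit of [sigma], and [ell] is equivariant. *)
Lemma ell_mod_CE (sigma : stab R D) :
  ell_mod_C (stab_proj sigma) = Cprod_proj (ell sigma).
Proof.
apply/Cprod_projP; have : stab_proj (repr (stab_proj sigma)) = stab_proj sigma.
  exact: reprK.
by move/stab_projP => [w e]; exists w; rewrite -ell_act -e.
Qed.

Lemma ell_mod_C_continuous : continuous ell_mod_C.
Proof.
apply/quotient_continuous.
have -> : ell_mod_C \o \pi_(stab_mod_C R D) = (@Cprod_proj R k D) \o (@ell R k D).
  by apply/funext => sigma; exact: ell_mod_CE.
move=> sigma; apply: continuous_comp; first exact: ell_continuous.
exact: pi_continuous.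
Qed.

(** By equivariance, images in one orbit mean that [ell tau] is the image of a translate of [sigma];
    injectivity of [ell] identifies [tau] with this translate. *)
Lemma ell_mod_C_inj : injective ell_mod_C.
Proof.
move=> x y; rewrite -[x]reprK -[y]reprK.
move: (repr x) (repr y) => sigma tau.
rewrite -[\pi sigma]/(stab_proj sigma) -[\pi tau]/(stab_proj tau) !ell_mod_CE.
move=> /Cprod_projP[w]; rewrite -ell_act => /ell_inj e.
by apply/stab_projP; exists w.
Qed.

End Quotient.

Theorem theorem2 (R : realType) (k : fieldType) (D : triCat k) :
  [/\ continuous (@dm R k D),
      continuous (@ell R k D),
      injective (@dm R k D),
      injective (@ell R k D) &
      exists ellbar : stab_mod_C R D -> Cprod_mod_C R D,
        [/\ forall sigma : stab R D,
              ellbar (stab_proj sigma) = Cprod_proj (ell sigma),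
            continuous ellbar &
            injective ellbar]].
Proof.
split.
- exact: dm_continuous.
- exact: ell_continuous.
(* [ell] factors through [dm], so its injectivity passes to [dm]. *)
- move=> sigma tau e; apply: ell_inj; apply/funext => C.
  by rewrite /ell e.
- exact: ell_inj.
- exists (@ell_mod_C R k D).
  by split; [exact: ell_mod_CE|exact: ell_mod_C_continuous|exact: ell_mod_C_inj].
Qed.
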